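(* For every fixed integer $d\geq 1$, as $n\to\infty$ through even integers $n>d$, \[ \mathbb{E}\operatorname{MaxCut}(G_{n,d})-\mathbb{E}\operatorname{MaxBis}(G_{n,d})=o(n). \] Moreover, there is a constant $b_d$ such that, in the same limit, \[ \frac1n\mathbb{E}\operatorname{MaxCut}(G_{n,d})\longrightarrow b_d,\qquad \frac1n\mathbb{E}\operatorname{MaxBis}(G_{n,d})\longrightarrow b_d . \]
   Context: For a finite undirected (multi)graph $G=(V,E)$ and $S\subseteq V$, $\operatorname{cut}_G(S)=e_G(S,V\setminus S)$ is the number of edges with exactly one endpoint in $S$ (multiple edges counted with multiplicity; loops contribute nothing). Define \[ \operatorname{MaxCut}(G)=\max_{S\subseteq V}\operatorname{cut}_G(S),\qquad \operatorname{MaxBis}(G)=\max_{S\subseteq V,\ |S|=\lfloor |V|/2\rfloor}\operatorname{cut}_G(S). \] For $d\ge 1$ and even $n>d$, $G_{n,d}$ is a uniformly random simple $d$-regular graph on the vertex set $[n]=\{1,\dots,n\}$. *)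

(* Defs.v *)
From HB Require Import structures.
From mathcomp Require Import all_boot all_order all_algebra.
From mathcomp Require Import all_classical all_reals all_analysis.

Set Implicit Arguments.
Unset Strict Implicit.
Unset Printing Implicit Defensive.

Import Order.TTheory GRing.Theory Num.Theory.
Import numFieldNormedType.Exports.

(* A simple graph on the vertex type V is given by its edge set, a set of
   two-element subsets of V; distinct values are distinct labelled graphs. *)
Definition simple_graph (V : finType) (E : {set {set V}}) : bool :=
  [forall e in E, #|e| == 2].

Definition degree (V : finType) (E : {set {set V}}) (v : V) : nat :=
  #|[set e in E | v \in e]|.

Definition regular_graph (V : finType) (d : nat) (E : {set {set V}}) : bool :=
  simple_graph E && [forall v, degree E v == d].

Definition graph_cut (V : finType) (E : {set {set V}}) (S : {set V}) : nat :=
  #|[set e in E | #|e :&: S| == 1]|.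

Definition MaxCut (V : finType) (E : {set {set V}}) : nat :=
  \max_(S : {set V}) graph_cut E S.

Definition MaxBis (V : finType) (E : {set {set V}}) : nat :=
  \max_(S : {set V} | #|S| == (#|V|)./2) graph_cut E S.

Local Open Scope ring_scope.

Definition uniform_mean (R : realType) (T : finType) (A : {set T})
    (f : T -> R) : R :=
  (\sum_(x in A) f x) / #|A|%:R.

(* When n is even and d < n, at least one d-regular graph on 'I_n exists, so
   the two means below are not divisions by zero on the range of the limit. *)
Definition regular_graphs (n d : nat) : {set {set {set 'I_n}}} :=
  [set E : {set {set 'I_n}} | regular_graph d E].

Definition E_MaxCut (R : realType) (d n : nat) : R :=
  uniform_mean (regular_graphs n d) (fun E => (MaxCut E)%:R).

Definition E_MaxBis (R : realType) (d n : nat) : R :=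
  uniform_mean (regular_graphs n d) (fun E => (MaxBis E)%:R).

Local Open Scope classical_set_scope.

Definition even_infty (d : nat) : set_system nat :=
  within [set n | ~~ odd n /\ (d < n)%N] \oo.

#[global] Instance even_infty_filter (d : nat) : ProperFilter (even_infty d).
Proof.
have FF : Filter (even_infty d) by rewrite /even_infty; exact: within_filter.
apply: Build_ProperFilter_ex => P [N _ NP].
have leN : (N <= (N + d.+1).*2)%N by rewrite -addnn -addnA leq_addr.
exists (N + d.+1).*2; apply: NP => //=; rewrite odd_double; split => //.
by rewrite -addnn (leq_trans _ (leq_addl _ _)) // leq_addl.
Qed.

(* Lets the Landau notation =o_F find the filter structure of F := even_infty d;
   =o_(even_infty d) does not parse. *)
Canonical even_infty_filter_on (d : nat) : filter_on nat :=
  FilterType (even_infty d) (@even_infty_filter d).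

(* Main.v *)
(* In the configuration model a random d-regular multigraph on [n] is obtained
   by pairing the points of [n] x [d] with a uniformly random permutation. Fix
   the colours (blocks of vertices) of all the half-edges. Adding an edge that
   joins blocks c and c' then raises the expected maximum by 1 - Q(c, c'), where
   Q(c, c') is the probability that random free points of c and c' are never
   separated by an optimal cut; "never separated" is an equivalence relation, so
   Q is positive semidefinite and 2 Q(c, c') <= Q(c, c) + Q(c', c'). Hence
   replacing every edge (c, c') by (c, c) or (c', c'), according to a fair coin,
   lowers the expected maximum up to o(n): pairing inside blocks is worse than
   pairing everything. This holds for any prescribed set of cuts, in particular
   for bisections. Inside disjoint blocks of m vertices, flipping maximum cuts of
   some of the blocks makes their union balanced up to m, so
     MaxBis(n) / n >= MaxCut(m) / m - o(1)   as n -> oo and then m -> oo,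
   which together with MaxBis <= MaxCut gives a common limit. Expectations pass
   between the configuration model and simple graphs because a configuration is
   simple with probability at least n^(-C), by switchings, whereas the maximum,
   a Lipschitz function of the permutation, is concentrated exponentially. *)
Require Import Defs.
From HB Require Import structures.
From mathcomp Require Import all_boot all_order all_algebra fingroup perm.
From mathcomp Require Import all_classical all_reals all_analysis.
From mathcomp Require Import zify ring lra.

Set Implicit Arguments.
Unset Strict Implicit.
Unset Printing Implicit Defensive.

Import Order.TTheory GRing.Theory Num.Theory.
Import numFieldNormedType.Exports.

Local Open Scope ring_scope.

(** * Means over finite sets and permutation groups *)

(** The fair-coin replacement does not preserve colour counts: an edge with two colours gives one of
    them a second half-edge and takes one from the other. A colour may thus come to hold more
    half-edges than its block has points, and the expected maximum loses its meaning. Three devices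
    repair this: the pairing is first thinned to leave [2k] points of every colour in reserve; edges
    at overfull colours are discarded inside the interpolating quantity; an exponential potential, a
    Chernoff bound carried along the induction, pays for the discards. The reserve has a second use:
    the kernel inequality compares sets of points, whereas an edge needs two distinct points, and
    with [k] free points in both blocks the diagonal costs only [1 / k] per edge. For blocks of
    order [M] and [k] a small multiple of [M], thinning costs [2k] edges per block, the diagonal a
    bounded number and overflow an exponentially small amount, all small against [M]. Concentration
    is applied to [lam * f]: a tilt [lam] of order [e] keeps the quadratic term below [e n], and any
    exponential factor beats [n^C]. *)

Section UniformMean.
Variables (R : realType) (T : finType).
Implicit Types (A : {set T}) (f g : T -> R).

Lemma ler_mean A f g : {in A, forall x, f x <= g x} ->
  uniform_mean A f <= uniform_mean A g.
Proof.
by move=> fg; rewrite ler_wpM2r ?invr_ge0 ?ler0n// ler_sum.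
Qed.

Lemma eq_mean A f g : {in A, f =1 g} -> uniform_mean A f = uniform_mean A g.
Proof. by move=> fg; congr (_ / _); apply: eq_bigr. Qed.

Lemma mean_cst A (c : R) : A != finset.set0 -> uniform_mean A (fun=> c) = c.
Proof.
rewrite -card_gt0 => A0.
rewrite /uniform_mean sumr_const -[c *+ _]mulr_natr mulfK//.
by rewrite pnatr_eq0 -lt0n.
Qed.

Lemma meanD A f g :
  uniform_mean A (fun x => f x + g x) = uniform_mean A f + uniform_mean A g.
Proof. by rewrite /uniform_mean big_split mulrDl. Qed.

Lemma meanZ A (c : R) f :
  uniform_mean A (fun x => c * f x) = c * uniform_mean A f.
Proof. by rewrite /uniform_mean -mulr_sumr mulrA. Qed.

Lemma meanN A f : uniform_mean A (fun x => - f x) = - uniform_mean A f.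
Proof. by rewrite /uniform_mean sumrN mulNr. Qed.

Lemma meanB A f g :
  uniform_mean A (fun x => f x - g x) = uniform_mean A f - uniform_mean A g.
Proof. by rewrite meanD meanN. Qed.

Lemma meanDc A f (c : R) : A != finset.set0 ->
  uniform_mean A (fun x => f x + c) = uniform_mean A f + c.
Proof. by move=> A0; rewrite meanD mean_cst. Qed.

Lemma mean_sum A (I : Type) (s : seq I) (Q : pred I) (F : I -> T -> R) :
  uniform_mean A (fun x => \sum_(i <- s | Q i) F i x) =
  \sum_(i <- s | Q i) uniform_mean A (F i).
Proof. by rewrite /uniform_mean exchange_big mulr_suml. Qed.

Lemma mean_dist A f (c e : R) : A != finset.set0 ->
  {in A, forall x, `|f x - c| <= e} -> `|uniform_mean A f - c| <= e.
Proof.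
move=> A0 fc; rewrite ler_distl; apply/andP; split.
- rewrite -(mean_cst (c - e) A0); apply: ler_mean => x /fc.
  by rewrite ler_distl => /andP[].
- rewrite -[leRHS](mean_cst (c + e) A0); apply: ler_mean => x /fc.
  by rewrite ler_distl => /andP[].
Qed.

Lemma mean_reindex A (h : T -> T) f : injective h ->
  {in A, forall x, h x \in A} ->
  uniform_mean A (f \o h) = uniform_mean A f.
Proof.
move=> hI hA; rewrite /uniform_mean; congr (_ / _).
rewrite -[RHS](_ : \sum_(x in h @: A) f x = _).
  by rewrite big_imset //= => x y _ _; exact: hI.
apply: eq_bigl => x; have/eqP-> // : h @: A == A.
rewrite eqEcard card_imset// leqnn andbT.
by apply/fintype.subsetP => _ /imsetP[y yA ->]; exact: hA.
Qed.

End UniformMean.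

Lemma mean_exchange (R : realType) (T U : finType) (A : {set T}) (B : {set U})
    (f : T -> U -> R) :
  uniform_mean A (fun x => uniform_mean B (f x)) =
  uniform_mean B (fun y => uniform_mean A (f^~ y)).
Proof.
rewrite /uniform_mean -!mulr_suml exchange_big /=.
by rewrite -!mulrA; congr (_ * _); rewrite mulrC.
Qed.

Section Permutations.
Variable P : finType.
Implicit Types (A : {set P}) (s t : {perm P}).

(** Built by transpositions: [s] is corrected by swapping [s x] with the required image [y], two
    points of the same colour, and freshness of [x] and [y] keeps the images already fixed. *)
Lemma perm_extension (C : eqType) (b : P -> C) (u v : seq P) :
  uniq u -> uniq v -> [seq b x | x <- u] = [seq b x | x <- v] ->
  exists s : {perm P}, (forall x, b (s x) = b x) /\ [seq s x | x <- u] = v.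
Proof.
elim: u v => [|x u IH] [|y v] //= => [_ _ _|].
  by exists 1%g; split => // x; rewrite perm1.
move=> /andP[xu uu] /andP[yv uv] [bxy buv].
have [s [bs suv]] := IH v uu uv buv.
exists (s * tperm (s x) y)%g; split.
  by move=> z; rewrite permM; case: tpermP => [/perm_inj->|szy|_ _]; rewrite ?bs ?bxy // -szy ?bs.
rewrite permM tpermL; congr (_ :: _); rewrite -suv.
apply/eq_in_map => z zu; rewrite permM tpermD //.
- by apply: contraNneq xu => /perm_inj ->.
- by apply: contraNneq yv => ->; rewrite -suv map_f.
Qed.

(** Every [s] in [Sym A] is uniquely a permutation fixing [x] followed by [tperm x y], with
    [y = s x]; revealing the image of [x] is one martingale step of the concentration argument. *)
Lemma sum_Sym_coset (V : nmodType) A x (f : {perm P} -> V) : x \in A ->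
  \sum_(s in Sym A) f s =
  \sum_(y in A) \sum_(s in Sym (A :\ x)) f (s * tperm x y)%g.
Proof.
move=> xA; rewrite (partition_big (fun s : {perm P} => s x) (mem A)) /=; last first.
  by move=> s; rewrite finset.inE => sA; rewrite (perm_closed _ sA).
apply: eq_bigr => y yA.
rewrite (reindex_onto (fun s => s * tperm x y)%g (fun s => s * tperm x y)%g) /=;
  last first.
  by move=> s _; rewrite -mulgA tperm2 mulg1.
apply: eq_bigl => s; rewrite -mulgA tperm2 mulg1 eqxx andbT permM !finset.inE.
have txy : perm_on A (tperm x y).
  apply: fintype.subset_trans (tperm_on x y) _.
  by apply/fintype.subsetP => z; rewrite !finset.inE => /orP[] /eqP->.
apply/andP/idP => [[sA /eqP sx]|sA].
  have {}sx : s x = x by apply: (@perm_inj _ (tperm x y)); rewrite sx tpermL.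
  have {}sA : perm_on A s.
    by rewrite -(mulg1 s) -(tperm2 x y) mulgA; exact: perm_onM.
  apply/fintype.subsetP => z zs; rewrite !finset.inE.
  rewrite (fintype.subsetP sA) // andbT.
  by apply: contraTneq zs => ->; rewrite unfold_in /= sx eqxx.
have sAx : s x = x by apply: (out_perm sA); rewrite !finset.inE eqxx.
rewrite sAx tpermL eqxx; split => //; apply: perm_onM => //.
by apply: fintype.subset_trans sA _; exact: finset.subsetDl.
Qed.

Lemma mean_Sym_coset (R : realType) A x (f : {perm P} -> R) : x \in A ->
  uniform_mean (Sym A) f =
  uniform_mean A (fun y => uniform_mean (Sym (A :\ x))
    (fun s => f (s * tperm x y)%g)).
Proof.
move=> xA; rewrite /uniform_mean (sum_Sym_coset _ xA) -mulr_suml -mulrA.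
congr (_ * _); rewrite !card_Sym (cardsD1 x A) xA add1n factS natrM.
by rewrite invfM mulrC.
Qed.

End Permutations.

(** * Concentration on the symmetric group *)

(** From [1 - x / 2 <= expR (- (x / 2))] follows [expR x * (1 - x / 2) ^+ 2 <= 1]; the claimed bound
    times [(1 - x / 2) ^+ 2] exceeds [1] by [x^2 (1 - x) (5 - 2 x) / 4]. *)
Lemma expR_le_quadratic (R : realType) (x : R) : `|x| <= 1 ->
  expR x <= 1 + x + 2 * x ^+ 2.
Proof.
rewrite ler_norml => /andP[x1 x2].
have e0 : 1 - x / 2 <= expR (- (x / 2)) by exact: expR_ge1Dx.
have e1 : expR (x / 2) * expR (- (x / 2)) = 1 by rewrite expRN mulfV// gt_eqF// expR_gt0.
have e2 : expR x = expR (x / 2) ^+ 2 by rewrite expr2 -expRD; congr expR; lra.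
have y0 : 0 < expR (x / 2) by exact: expR_gt0.
have e3 : expR (x / 2) * (1 - x / 2) <= 1 by rewrite -[X in _ <= X]e1 ler_pM2l.
have e4 : expR x * (1 - x / 2) ^+ 2 <= 1.
  rewrite e2 -exprMn expr_le1//.
  by rewrite mulr_ge0 ?expR_ge0//; lra.
have e5 : 1 <= (1 + x + 2 * x ^+ 2) * (1 - x / 2) ^+ 2.
  have : 0 <= x ^+ 2 * ((1 - x) * (5 - 2 * x)).
    rewrite mulr_ge0 ?sqr_ge0 // mulr_ge0 //; lra.
  rewrite -subr_ge0 [X in _ -> 0 <= X](_ : _ = (x ^+ 2 * ((1 - x) * (5 - 2 * x))) / 4).
    by lra.
  by field.
have h0 : 0 < (1 - x / 2) ^+ 2 by rewrite exprn_gt0//; lra.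
by rewrite -(ler_pM2r h0) (le_trans e4 e5).
Qed.

Section Concentration.
Variables (R : realType) (P : finType).
Implicit Types (A : {set P}) (f : {perm P} -> R).

(** Right multiplication exchanges two values of [s], not two arguments, in agreement with the coset
    decomposition. *)
Definition tperm_lipschitz (c : R) f :=
  forall (s : {perm P}) x y, `|f (s * tperm x y)%g - f s| <= c.

Lemma tperm_lipschitz_coset c f x y : tperm_lipschitz c f ->
  tperm_lipschitz c (fun s => f (s * tperm x y)%g).
Proof.
move=> cf s u v; rewrite -mulgA.
have -> : (tperm u v * tperm x y = tperm x y * tperm (tperm x y u) (tperm x y v))%g.
  by rewrite -tpermJ /conjg !mulgA tpermV tperm2 mul1g.
by rewrite mulgA.
Qed.

Lemma Sym_neq0 A : Sym A != finset.set0.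
Proof. by rewrite -card_gt0 card_Sym fact_gt0. Qed.

(** Azuma's inequality, by induction on [#|A|]. Given [s x = y], the conditional means [mu y] lie
    within [2 * c] of the mean; the linear term averages out, and each revealed value costs a factor
    [1 + 8 c^2 <= expR (8 c^2)]. *)
Lemma mgf_Sym (c : R) A f : tperm_lipschitz c f -> 0 <= c -> 2 * c <= 1 ->
  uniform_mean (Sym A) (fun s => expR (f s - uniform_mean (Sym A) f)) <=
  expR (8 * c ^+ 2 * #|A|%:R).
Proof.
move=> cf c0 c1; elim: {A}#|A| {-2}A (erefl #|A|) f cf => [|k IH] A Ak f cf.
  have A0 : A = finset.set0 by apply/eqP; rewrite -cards_eq0 Ak.
  have S1 s : s \in Sym A -> s = 1%g.
    by rewrite finset.inE => /perm_on_id; apply; rewrite Ak.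
  have m1 : uniform_mean (Sym A) f = f 1%g.
    rewrite -[RHS](mean_cst _ (Sym_neq0 A)).
    by apply: eq_mean => s /S1 ->.
  rewrite Ak mulr0 expR0 -[leRHS](mean_cst _ (Sym_neq0 A)).
  by apply: ler_mean => s /S1 ->; rewrite m1 subrr expR0.
have /card_gt0P[x xA] : (0 < #|A|)%N by rewrite Ak.
have A0 : A != finset.set0 by apply/set0Pn; exists x.
set B := A :\ x.
have Bk : #|B| = k by move: Ak; rewrite (cardsD1 x A) xA add1n => -[].
pose g y (s : {perm P}) := f (s * tperm x y)%g.
pose mu y := uniform_mean (Sym B) (g y).
set m := uniform_mean (Sym A) f.
have mE : m = uniform_mean A mu by rewrite /m (mean_Sym_coset _ xA).
(* [tperm x x] is the identity, so [mu x] involves no transposition and serves as reference for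
   every [mu y]. *)
have mu_x y : `|mu y - mu x| <= c.
  rewrite /mu -meanB -[X in `|X|]subr0; apply: mean_dist; first exact: Sym_neq0.
  move=> s _; rewrite subr0 /g tperm1 mulg1; exact: cf.
have m_x : `|m - mu x| <= c by rewrite mE; apply: mean_dist.
have mu_m y : `|mu y - m| <= 2 * c.
  rewrite (_ : _ - _ = (mu y - mu x) - (m - mu x)); last by ring.
  by rewrite (le_trans (ler_normB _ _))// mulr_natl mulr2n lerD.
rewrite (mean_Sym_coset _ xA).
have step y : y \in A ->
    uniform_mean (Sym B) (fun s => expR (f (s * tperm x y)%g - m)) <=
    (1 + (mu y - m) + 2 * (2 * c) ^+ 2) * expR (8 * c ^+ 2 * k%:R).
  move=> yA.
  have -> : uniform_mean (Sym B) (fun s => expR (f (s * tperm x y)%g - m)) =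
      expR (mu y - m) * uniform_mean (Sym B) (fun s => expR (g y s - mu y)).
    rewrite -meanZ; apply: eq_mean => s _; rewrite -expRD; congr expR.
    by rewrite /g; ring.
  apply: ler_pM; rewrite ?expR_ge0//.
  - apply: le_trans (_ : uniform_mean (Sym B) (fun=> 0) <= _).
      by rewrite mean_cst// Sym_neq0.
    by apply: ler_mean => s _; rewrite expR_ge0.
  - apply: le_trans (expR_le_quadratic _) _; first exact: le_trans (mu_m y) c1.
    rewrite lerD2l ler_wpM2l//.
    by rewrite -(real_normK (num_real (mu y - m))) lerXn2r ?nnegrE// mulr_ge0.
  - by rewrite -Bk; apply: IH => //; exact: tperm_lipschitz_coset.
apply: le_trans (ler_mean step) _.
have -> : uniform_mean A (fun y => (1 + (mu y - m) + 2 * (2 * c) ^+ 2) *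
      expR (8 * c ^+ 2 * k%:R)) = (1 + 8 * c ^+ 2) * expR (8 * c ^+ 2 * k%:R).
  rewrite (eq_mean (g := fun y => expR (8 * c ^+ 2 * k%:R) *
     (mu y + (1 - m + 8 * c ^+ 2)))); last by move=> y _; ring.
  by rewrite meanZ meanDc// -mE; ring.
rewrite Ak -[k.+1%:R]natr1 mulrDr mulr1 expRD [leRHS]mulrC ler_wpM2r ?expR_ge0//.
exact: expR_ge1Dx.
Qed.

Lemma jensen_expR (T : finType) (A : {set T}) (g : T -> R) : A != finset.set0 ->
  expR (uniform_mean A g) <= uniform_mean A (expR \o g).
Proof.
move=> A0; set m := uniform_mean A g.
apply: le_trans (_ : uniform_mean A (fun x => expR m * (1 + (g x - m))) <= _).
  rewrite meanZ (eq_mean (g := fun x => g x + (1 - m))); last by move=> x _; ring.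
  by rewrite meanDc// -/m addrCA subrr addr0 mulr1.
apply: ler_mean => x _ /=.
have -> : expR (g x) = expR m * expR (g x - m).
  by rewrite -expRD; congr expR; ring.
by rewrite ler_wpM2l ?expR_ge0//; exact: expR_ge1Dx.
Qed.

(* A Lipschitz function is so concentrated that conditioning on an event of
   probability e^(-o(#|P|)) moves its mean by o(#|P|) only. *)
Lemma mean_subset_upper (c eta : R) (S : {set {perm P}}) f :
  tperm_lipschitz c f -> 0 <= c -> 2 * c <= 1 -> S != finset.set0 ->
  (#|P|)`!%:R <= expR eta * #|S|%:R ->
  uniform_mean S f - uniform_mean [set: {perm P}] f <=
  eta + 8 * c ^+ 2 * #|P|%:R.
Proof.
move=> cf c0 c1 S0 Seta; set m := uniform_mean [set: {perm P}] f.
have ST : [set: {perm P}] = Sym [set: P].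
  apply/setP => s; rewrite !finset.inE.
  by apply/esym/fintype.subsetP => z; rewrite finset.inE.
rewrite -ler_expR.
have -> : uniform_mean S f - m = uniform_mean S (fun s => f s - m).
  by rewrite meanDc.
apply: le_trans (jensen_expR _ S0) _.
have mg := mgf_Sym [set: P] cf c0 c1; rewrite cardsT -ST -/m in mg.
rewrite expRD; apply: le_trans (ler_wpM2l (expR_ge0 _) mg).
rewrite {1}/uniform_mean {1}/uniform_mean mulrCA.
have S1 : (0 : R) < #|S|%:R by rewrite ltr0n card_gt0.
have P1 : (0 : R) < (#|P|)`!%:R by rewrite ltr0n fact_gt0.
have -> : #|[set: {perm P}]| = (#|P|)`! by rewrite ST card_Sym cardsT.
apply: ler_pM; rewrite ?invr_ge0 ?ler0n//.
- by apply: sumr_ge0 => s _; exact: expR_ge0.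
- rewrite [leRHS](bigID (fun s => s \in S)) /=.
  rewrite -[leLHS]addr0 lerD//; last by apply: sumr_ge0 => s _; exact: expR_ge0.
  by rewrite le_eqVlt; apply/orP; left; apply/eqP; apply: eq_bigl => s; rewrite finset.inE.
- by rewrite ler_pdivlMr// mulrC ler_pdivrMr.
Qed.

(** Applying the upper bound to [lam * f] and dividing by [lam] trades the conditioning cost
    [eta / lam] against the variance term; [- f] gives the other side. *)
Lemma mean_subset_dist (c lam eta : R) (S : {set {perm P}}) f :
  tperm_lipschitz c f -> 0 <= c -> 0 < lam -> 2 * (lam * c) <= 1 ->
  S != finset.set0 -> (#|P|)`!%:R <= expR eta * #|S|%:R ->
  `|uniform_mean S f - uniform_mean [set: {perm P}] f| <=
  eta / lam + 8 * lam * c ^+ 2 * #|P|%:R.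
Proof.
move=> cf c0 l0 lc S0 Seta.
have up (g : {perm P} -> R) : tperm_lipschitz c g ->
    uniform_mean S g - uniform_mean [set: {perm P}] g <=
    eta / lam + 8 * lam * c ^+ 2 * #|P|%:R.
  move=> cg; have clg : tperm_lipschitz (lam * c) (fun s => lam * g s).
    by move=> s x y; rewrite -mulrBr normrM gtr0_norm// ler_pM2l.
  have := mean_subset_upper clg (mulr_ge0 (ltW l0) c0) lc S0 Seta.
  rewrite !meanZ -mulrBr -ler_pdivlMl// => /le_trans; apply.
  rewrite mulrDr mulrC lerD2l exprMn.
  rewrite (_ : lam^-1 * _ = (lam^-1 * lam) * (8 * lam * c ^+ 2 * #|P|%:R)); last by ring.
  by rewrite mulVf ?mul1r// gt_eqF.
rewrite ler_norml up// andbT lerNl opprB addrC.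
have := up (fun s => - f s); rewrite !meanN opprK; apply.
by move=> s x y; rewrite -opprD normrN; exact: cf.
Qed.

End Concentration.

(** * Maximal numbers of separated edges *)

Section EdgeLists.
Implicit Types T U : Type.

Definition pts T (l : seq (T * T)) : seq T := flatten [seq [:: e.1; e.2] | e <- l].

Definition emap T U (h : T -> U) (l : seq (T * T)) : seq (U * U) :=
  [seq (h e.1, h e.2) | e <- l].

Lemma pts_emap T U (h : T -> U) l : pts (emap h l) = [seq h x | x <- pts l].
Proof. by rewrite /pts map_flatten -!map_comp. Qed.

Lemma emap_cons T U (h : T -> U) e l :
  emap h (e :: l) = (h e.1, h e.2) :: emap h l.
Proof. by []. Qed.

Lemma size_pts T (l : seq (T * T)) : size (pts l) = (size l).*2.
Proof. by elim: l => //= e l IH; rewrite -[flatten _]/(pts l) IH doubleS. Qed.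

Lemma pts_cat T (l l' : seq (T * T)) : pts (l ++ l') = pts l ++ pts l'.
Proof. by rewrite /pts map_cat flatten_cat. Qed.

Lemma pts_inj T : injective (@pts T).
Proof. by elim=> [|[u v] l IH] [|[u' v'] l'] //= [-> -> /IH ->]. Qed.

Lemma emap_comp T U V (h : U -> V) (g : T -> U) l :
  emap h (emap g l) = emap (fun x => h (g x)) l.
Proof. by rewrite /emap -map_comp. Qed.

Lemma perm_pts (T : eqType) (l l' : seq (T * T)) :
  perm_eq l l' -> perm_eq (pts l) (pts l').
Proof. by move=> ll'; apply: perm_flatten; exact: perm_map. Qed.

Lemma subseq_pts (T : eqType) (l l' : seq (T * T)) :
  subseq l l' -> subseq (pts l) (pts l').
Proof.
elim: l' l => [|e' l' IH] [|e l] //.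
rewrite [subseq _ _]/=; case: eqP => [->|_] /IH sl.
  exact: (cat_subseq (subseq_refl [:: e'.1; e'.2]) sl).
by apply: subseq_trans sl _; exact: (suffix_subseq [:: e'.1; e'.2]).
Qed.

End EdgeLists.

Section MaxSeparation.
Variables (P I : finType) (A : {set I}) (col : I -> P -> bool).
Implicit Type l : seq (P * P).

Definition sep (i : I) (e : P * P) := col i e.1 != col i e.2.

Definition maxsep l : nat := \max_(i in A) count (sep i) l.

Lemma maxsep_subseq l l' : subseq l l' -> (maxsep l <= maxsep l')%N.
Proof.
move=> ll'; apply/bigmax_leqP => i iA.
by apply: leq_trans (leq_count_subseq _ ll') _; exact: leq_bigmax_cond.
Qed.

Lemma maxsep_size l l' : subseq l l' ->
  (maxsep l' <= maxsep l + (size l' - size l))%N.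
Proof.
move=> ll'; apply/bigmax_leqP => i iA.
have h1 : (count (sep i) l <= maxsep l)%N by exact: leq_bigmax_cond.
have h2 := leq_count_subseq (predC (sep i)) ll'.
rewrite -(count_predC (sep i) l) -(count_predC (sep i) l').
move: (count (predC _) l) (count (predC _) l') (count _ l) (count _ l') (maxsep l) h1 h2 => *; lia.
Qed.

Lemma maxsep_perm l l' : perm_eq l l' -> maxsep l = maxsep l'.
Proof. by move=> /seq.permP ll'; apply: eq_bigr => i _; exact: ll'. Qed.

(** Records the side of [x] in each optimal cut, with false at all other cuts. Two points are never
    separated by an optimal cut exactly when these values agree, which makes the relation a plain
    equality. *)
Definition optimal_profile l (x : P) : {ffun I -> bool} :=
  [ffun i => [&& i \in A, count (sep i) l == maxsep l & col i x]].

Lemma maxsep_cons u v l : A != finset.set0 ->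
  maxsep ((u, v) :: l) =
  (maxsep l + (optimal_profile l u != optimal_profile l v))%N.
Proof.
move=> A0; have [i0 i0A i0max] : exists2 i, i \in A & count (sep i) l = maxsep l.
  have [|i iA im] := @eq_bigmax_cond _ (mem A) (fun i => count (sep i) l).
    by rewrite card_gt0.
  by exists i.
apply/eqP; rewrite eqn_leq; apply/andP; split.
  apply/bigmax_leqP => i iA /=; rewrite addnC.
  have h1 : (count (sep i) l <= maxsep l)%N by exact: leq_bigmax_cond.
  have [e|ne] := eqVneq (count (sep i) l) (maxsep l); last first.
    have : (count (sep i) l < maxsep l)%N by rewrite ltn_neqAle ne.
    by case: (sep _ _); case: (_ != _) => /=; lia.
  rewrite e leq_add2l; case: eqP => [|_]; last by case: sep.
  move=> /ffunP/(_ i); rewrite !ffunE iA e eqxx /= => cuv.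
  by rewrite /sep /= cuv eqxx.
case: eqP => [_|/eqP neq] /=.
  by rewrite addn0; apply: maxsep_subseq; exact: subseq_cons.
have /existsP[i] : [exists i, optimal_profile l u i != optimal_profile l v i].
  by apply: contraNT neq; rewrite negb_exists => /forallP H; apply/eqP/ffunP => i; apply/eqP/negPn.
rewrite !ffunE; have [iA|] := boolP (i \in A) => //=.
have [im|] := eqVneq (count (sep i) l) (maxsep l) => //= cuv.
rewrite addn1 -im; apply: leq_trans (leq_bigmax_cond _ iA).
by rewrite /= /sep cuv.
Qed.

End MaxSeparation.

(** With [m Z w] the number of points of [Z] in class [w], the difference of the two sides is the
    sum over [w] of [(m X w - m Y w) ^+ 2]. *)
Lemma equivalence_kernel_psd (R : realType) (P W : finType) (r : P -> W)
    (X Y : {set P}) :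
  2 * \sum_(x in X) \sum_(y in Y) (r x == r y)%:R <=
  \sum_(x in X) \sum_(y in X) (r x == r y)%:R +
  \sum_(x in Y) \sum_(y in Y) (r x == r y)%:R :> R.
Proof.
pose m (Z : {set P}) w : R := \sum_(x in Z) (r x == w)%:R.
have E (Z Z' : {set P}) : \sum_(x in Z) \sum_(y in Z') (r x == r y)%:R =
    \sum_w m Z w * m Z' w.
  rewrite /m; under [RHS]eq_bigr do rewrite mulr_suml.
  rewrite [RHS]exchange_big; apply: eq_bigr => x _ /=.
  under [RHS]eq_bigr do rewrite mulr_sumr.
  rewrite [RHS]exchange_big; apply: eq_bigr => y _ /=.
  rewrite (bigD1 (r x)) //= eqxx mul1r big1 ?addr0 1?eq_sym // => w wx.
  by rewrite eq_sym (negbTE wx) mul0r.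
rewrite !E mulr_sumr -big_split /=; apply: ler_sum => w _.
have := sqr_ge0 (m X w - m Y w); lra.
Qed.

(** * Averages over colour-preserving permutations and the convexity inequality *)

Section BlockMean.
Variables (R : realType) (P I C : finType) (A : {set I}) (col : I -> P -> bool).
Variable b : P -> C.
Hypothesis A0 : A != finset.set0.
Implicit Types (l : seq (P * P)) (g : seq (C * C)).
Local Notation F := (maxsep A col).

Definition block_perms : {set {perm P}} :=
  [set s : {perm P} | [forall x, b (s x) == b x]].

Definition block_mean l : R :=
  uniform_mean block_perms (fun s => (F (emap s l))%:R).

Lemma block_permsP (s : {perm P}) :
  reflect (forall x, b (s x) = b x) (s \in block_perms).
Proof.
by rewrite finset.inE; apply: (iffP forallP) => sb x; apply/eqP; rewrite sb.
Qed.

Lemma block_perms_neq0 : block_perms != finset.set0.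
Proof. by apply/set0Pn; exists 1%g; apply/block_permsP => x; rewrite perm1. Qed.

Lemma mean_block_permsM (s : {perm P}) (f : {perm P} -> R) : s \in block_perms ->
  uniform_mean block_perms (fun t => f (s * t)%g) = uniform_mean block_perms f.
Proof.
move=> /block_permsP sb; apply: (mean_reindex _ (h := fun t => (s * t)%g)).
  exact: mulgI.
by move=> t /block_permsP tb; apply/block_permsP => x; rewrite permM tb sb.
Qed.

Lemma emap_permM (s t : {perm P}) l : emap (s * t)%g l = emap t (emap s l).
Proof. by rewrite emap_comp; apply: eq_map => e; rewrite !permM. Qed.

(** By [perm_extension], the group [block_perms] is transitive on duplicate-free point lists with
    given colours, and translating by one of its elements does not change the mean. *)
Lemma block_mean_types l l' : uniq (pts l) -> uniq (pts l') ->
  emap b l = emap b l' -> block_mean l = block_mean l'.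
Proof.
move=> ul ul' bll'.
have [|s [sb sl]] := @perm_extension _ _ b _ _ ul ul'.
  by rewrite -!pts_emap bll'.
have -> : l' = emap s l by apply: pts_inj; rewrite pts_emap sl.
rewrite /block_mean -(mean_block_permsM (s := s)); last exact/block_permsP.
by apply: eq_mean => t _; rewrite emap_permM.
Qed.

Lemma block_mean_perm l l' : perm_eq l l' -> block_mean l = block_mean l'.
Proof.
move=> ll'; apply: eq_mean => s _; congr (_ %:R).
by apply: maxsep_perm; exact: perm_map.
Qed.

Lemma block_mean_subseq l l' : subseq l l' ->
  block_mean l <= block_mean l' <= block_mean l + (size l' - size l)%N%:R.
Proof.
move=> ll'; have sll' (s : {perm P}) : subseq (emap s l) (emap s l') by exact: map_subseq.
rewrite -[X in _ <= _ <= X]meanDc ?block_perms_neq0//.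
apply/andP; split; apply: ler_mean => s _.
  by rewrite ler_nat maxsep_subseq.
by rewrite -natrD ler_nat (leq_trans (maxsep_size _ _ (sll' s)))// !size_map.
Qed.

(** The probability [Q] for concrete points; it is a function of their colours when they are
    distinct and not among the points of [l]. *)
Let clash l (x y : P) : R := uniform_mean block_perms (fun s =>
  (optimal_profile A col (emap s l) (s x) ==
   optimal_profile A col (emap s l) (s y))%:R).

Lemma block_mean_cons l x y : block_mean ((x, y) :: l) = block_mean l + 1 - clash l x y.
Proof.
rewrite /block_mean /clash -meanDc ?block_perms_neq0// -meanB.
apply: eq_mean => s _; rewrite /= maxsep_cons// natrD.
by case: eqP => _ /=; ring.
Qed.

Lemma exists_subset (X : {set P}) k : (k <= #|X|)%N ->
  exists2 Y : {set P}, Y \subset X & #|Y| = k.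
Proof.
move=> kX; exists [set x in take k (enum X)].
  by apply/fintype.subsetP => x; rewrite finset.inE => /mem_take; rewrite mem_enum.
have u : uniq (take k (enum X)) by rewrite take_uniq ?enum_uniq.
rewrite cardsE; rewrite (card_uniqP u).
by rewrite size_take_min -cardE; apply/minn_idPl.
Qed.

Definition free_points l c : {set P} := [set x | (b x == c) && (x \notin pts l)].

Lemma uniq_pts_cons l c c' x y : uniq (pts l) -> x \in free_points l c ->
  y \in free_points l c' -> x != y -> uniq (pts ((x, y) :: l)).
Proof.
rewrite !finset.inE => ul /andP[_ xl] /andP[_ yl] xy.
by rewrite /= -[flatten _]/(pts l) ul yl inE negb_or xy xl.
Qed.

(** The kernel inequality is summed over [k] free points of either colour and divided by [k^2].
    Off-diagonal terms are equal by exchangeability, while the [k] diagonal terms of each colour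
    equal [1]; they cost [1 / k] per colour. *)
Lemma block_mean_convex l c c' k u1 u2 v1 v2 x y : uniq (pts l) -> (0 < k)%N ->
  (k <= #|free_points l c|)%N -> (k <= #|free_points l c'|)%N ->
  u1 \in free_points l c -> u2 \in free_points l c -> u1 != u2 ->
  v1 \in free_points l c' -> v2 \in free_points l c' -> v1 != v2 ->
  x \in free_points l c -> y \in free_points l c' -> x != y -> c != c' ->
  block_mean ((u1, u2) :: l) + block_mean ((v1, v2) :: l) <=
  2 * block_mean ((x, y) :: l) + 2 / k%:R.
Proof.
move=> ul k0 /exists_subset[X XF Xk] /exists_subset[Y YF Yk].
move=> u1F u2F u12 v1F v2F v12 xF yF xy cc'.
have clashE d d' x1 y1 x2 y2 : x1 \in free_points l d -> y1 \in free_points l d' -> x1 != y1 ->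
    x2 \in free_points l d -> y2 \in free_points l d' -> x2 != y2 -> clash l x1 y1 = clash l x2 y2.
  move=> h1 h2 h3 h4 h5 h6.
  have := block_mean_types (uniq_pts_cons ul h1 h2 h3) (uniq_pts_cons ul h4 h5 h6).
  rewrite !block_mean_cons /=; move: h1 h2 h4 h5; rewrite !finset.inE.
  by move=> /andP[/eqP-> _] /andP[/eqP-> _] /andP[/eqP-> _] /andP[/eqP-> _] /(_ erefl); lra.
have clash1 z : clash l z z = 1.
  rewrite /clash -[RHS](mean_cst 1 block_perms_neq0).
  by apply: eq_mean => s _; rewrite eqxx.
have clash0 z t : 0 <= clash l z t.
  rewrite /clash -(mean_cst 0 block_perms_neq0).
  by apply: ler_mean => s _; rewrite ler0n.
have diag d (Z : {set P}) z t : Z \subset free_points l d -> #|Z| = k ->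
    z \in free_points l d -> t \in free_points l d -> z != t ->
    \sum_(p in Z) \sum_(q in Z) clash l p q <= k%:R ^+ 2 * clash l z t + k%:R.
  move=> ZF Zk zF tF zt.
  apply: le_trans (_ : \sum_(p in Z) (k%:R * clash l z t + 1) <= _); last first.
    by rewrite sumr_const Zk -[leLHS]mulr_natl mulrDr mulr1 mulrA expr2.
  apply: ler_sum => p pZ.
  apply: le_trans (_ : \sum_(q in Z) (clash l z t + (p == q)%:R) <= _).
    apply: ler_sum => q qZ; have [<-|pq] := eqVneq p q.
      by rewrite clash1 lerDr.
    by rewrite addr0 (clashE d d p q z t)// (fintype.subsetP ZF).
  rewrite big_split /= sumr_const Zk -[clash l z t *+ _]mulr_natl lerD2l.
  by rewrite (bigD1 p) //= eqxx big1 ?addr0 // => q /andP[_ /negbTE]; rewrite eq_sym => ->.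
have hXY : \sum_(p in X) \sum_(q in Y) clash l p q = k%:R ^+ 2 * clash l x y.
  rewrite (eq_bigr (fun=> k%:R * clash l x y)) => [|p pX].
    by rewrite sumr_const Xk -[LHS]mulr_natl mulrA expr2.
  rewrite (eq_bigr (fun=> clash l x y)) => [|q qY]; first by rewrite sumr_const Yk -[LHS]mulr_natl.
  have pF := fintype.subsetP XF _ pX; have qF := fintype.subsetP YF _ qY.
  apply: (clashE c c') => //; apply: contra_neq cc' => pq; move: pF qF.
  by rewrite pq !finset.inE => /andP[/eqP-> _] /andP[/eqP-> _].
have psd : 2 * \sum_(p in X) \sum_(q in Y) clash l p q <=
    \sum_(p in X) \sum_(q in X) clash l p q + \sum_(p in Y) \sum_(q in Y) clash l p q.
  have S (Z Z' : {set P}) : \sum_(p in Z) \sum_(q in Z') clash l p q =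
      uniform_mean block_perms (fun s => \sum_(p in Z) \sum_(q in Z')
        (optimal_profile A col (emap s l) (s p) ==
         optimal_profile A col (emap s l) (s q))%:R).
    by rewrite mean_sum; apply: eq_bigr => p _; rewrite mean_sum.
  rewrite !S -meanZ -meanD; apply: ler_mean => s _.
  exact: (equivalence_kernel_psd _ (fun p => optimal_profile A col (emap s l) (s p))).
have k1 : (0 : R) < k%:R by rewrite ltr0n.
have := le_trans psd (lerD (diag c X u1 u2 XF Xk u1F u2F u12)
  (diag c' Y v1 v2 YF Yk v1F v2F v12)).
rewrite hXY !block_mean_cons => h.
have : 2 * clash l x y <= clash l u1 u2 + clash l v1 v2 + 2 / k%:R; last by lra.
have h2 : (0 : R) < k%:R ^+ 2 by rewrite exprn_gt0.
rewrite -(ler_pM2l h2).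
rewrite [leRHS](_ : _ = k%:R ^+ 2 * (clash l u1 u2 + clash l v1 v2) + 2 * k%:R); first by lra.
by field; rewrite gt_eqF.
Qed.

End BlockMean.

(** * Colour counts of lists of edge types *)

Section ColourCounts.
Variable C : finType.
Implicit Type g : seq (C * C).

Definition ncol (c : C) g : nat := count_mem c (pts g).

Lemma ncol_cons c x g : ncol c (x :: g) = ((x.1 == c) + (x.2 == c) + ncol c g)%N.
Proof. by rewrite /ncol /= -[flatten _]/(pts g) addnA. Qed.

Lemma ncol_cat c g g' : ncol c (g ++ g') = (ncol c g + ncol c g')%N.
Proof. by rewrite /ncol pts_cat count_cat. Qed.

Lemma ncol_subseq c g g' : subseq g g' -> (ncol c g <= ncol c g')%N.
Proof. by move=> /subseq_pts; exact: leq_count_subseq. Qed.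

Lemma ncol_perm c g g' : perm_eq g g' -> ncol c g = ncol c g'.
Proof. by move=> /perm_pts/seq.permP; apply. Qed.

Lemma size_avoid c c' g :
  (size g <= size [seq y <- g | [&& y.1 != c, y.1 != c', y.2 != c & y.2 != c']] +
     ncol c g + ncol c' g)%N.
Proof.
elim: g => //= x g IH; rewrite !ncol_cons.
by case: (x.1 == c); case: (x.1 == c'); case: (x.2 == c); case: (x.2 == c') => /=; lia.
Qed.

Lemma count_touching (Q : pred C) g :
  (count (fun x => Q x.1 || Q x.2) g <= \sum_(c | Q c) ncol c g)%N.
Proof.
elim: g => //= x g IH; under eq_bigr do rewrite ncol_cons.
rewrite !big_split /= leq_add ?IH //.
have S y : (\sum_(c | Q c) (y == c) = Q y)%N.
  rewrite big_mkcond (bigD1 y) //= eqxx big1 ?addn0; first by case: (Q y).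
  by move=> c cy; rewrite eq_sym (negbTE cy); case: ifP.
by rewrite !S; case: (Q x.1); case: (Q x.2).
Qed.

Lemma ncol_local c g : all (fun x => x.1 == x.2) g ->
  ncol c g = (count_mem (c, c) g).*2.
Proof.
elim: g => //= -[x y] g IH /= /andP[/eqP <- /IH]; rewrite ncol_cons /= => ->.
by rewrite xpair_eqE andbb; lia.
Qed.

(** Greedy: an edge is dropped exactly when keeping it would push some colour [c] above [t c]; the
    excess of the full list at [c] then grows by at least one and pays for the drop. *)
Lemma exists_bounded_subseq (T : eqType) (b : T -> C) (t : C -> nat) (l : seq (T * T)) :
  exists2 l', subseq l' l & (forall c, ncol c (emap b l') <= t c)%N /\
    (size l <= size l' + \sum_c (ncol c (emap b l) - t c))%N.
Proof.
elim: l => [|e l [l' sl [tl' szl]]].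
  by exists [::] => //; split => // c; rewrite /ncol /=.
have [/forallP ok|] :=
    boolP [forall c, (ncol c (emap b (e :: l')) <= t c)%N].
  exists (e :: l'); first by rewrite /= eqxx.
  split => //=; rewrite addSn ltnS; apply: leq_trans szl _.
  rewrite leq_add2l; apply: leq_sum => c _; apply: leq_sub2r.
  by rewrite ncol_cons leq_addl.
rewrite negb_forall => /existsP[c]; rewrite -ltnNge => tc.
exists l'; first exact: subseq_trans sl (subseq_cons _ _).
split => //=; apply: leq_trans (_ : (size l' + \sum_c (ncol c (emap b l) - t c)).+1 <= _)%N => //.
rewrite -addnS leq_add2l (bigD1 c) //= [leqRHS](bigD1 c) //= -addSn leq_add //.
  have := ncol_subseq c (map_subseq _ sl : subseq (emap b l') (emap b l)).
  move: tc (tl' c); rewrite !emap_cons !ncol_cons /=.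
  by case: (b e.1 == c); case: (b e.2 == c); lia.
by apply: leq_sum => d _; apply: leq_sub2r; rewrite ncol_cons leq_addl.
Qed.

End ColourCounts.

Section TypeMean.
Variables (R : realType) (P I C : finType) (A : {set I}) (col : I -> P -> bool).
Variable b : P -> C.
Hypothesis A0 : A != finset.set0.
Implicit Types (l : seq (P * P)) (g : seq (C * C)).

Definition block_size (c : C) : nat := #|[set x | b x == c]|.
Local Notation a := block_size.
Local Notation Phi := (block_mean R A col b).

Lemma ncol_emap c l : ncol c (emap b l) = count (fun x => b x == c) (pts l).
Proof. by rewrite /ncol pts_emap count_map; apply: eq_count. Qed.

Lemma card_free c l : uniq (pts l) -> (#|free_points b l c| + ncol c (emap b l))%N = a c.
Proof.
move=> ul; rewrite ncol_emap -size_filter.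
have u : uniq [seq x <- pts l | b x == c] by rewrite filter_uniq.
rewrite -(card_uniqP u) /block_size -(cardsID [set x in pts l] [set x | b x == c]).
rewrite addnC; congr (_ + _)%N.
  by apply: eq_card => x; rewrite !inE mem_filter.
by apply: eq_card => x; rewrite !inE andbC.
Qed.

Lemma realize_colours (s : seq C) : (forall c, count_mem c s <= a c)%N ->
  exists2 t : seq P, uniq t & [seq b x | x <- t] = s.
Proof.
elim: s => [|c s IH] sa; first by exists [::].
have [d|t ut bt] := IH; first by apply: leq_trans (sa d); exact: leq_addl.
have /card_gt0P[x] : (0 < #|[set x | b x == c] :\: [set x in t]|)%N.
  have := sa c; rewrite /= eqxx add1n => sac.
  rewrite cardsD subn_gt0; apply: leq_trans sac.
  rewrite ltnS -bt count_map -size_filter.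
  have u : uniq [seq x <- t | preim b (pred1 c) x] by rewrite filter_uniq.
  rewrite -(card_uniqP u); apply: subset_leq_card; apply/fintype.subsetP => x.
  by rewrite !inE mem_filter.
rewrite !inE => /andP[xt /eqP bx].
by exists (x :: t); rewrite /= ?xt ?ut ?bx ?bt.
Qed.

Lemma realize_types g : (forall c, ncol c g <= a c)%N ->
  exists l, uniq (pts l) /\ emap b l = g.
Proof.
move=> /realize_colours[t ut bt].
have [l lt lg] : exists2 l, pts l = t & emap b l = g.
  elim: g t bt {ut} => [|[c c'] g IH] [|x [|y t]] //=; first by exists [::].
  move=> [bx b'] /IH[l lt lg].
  by exists ((x, y) :: l); rewrite /= ?bx ?b' -?lt -?lg.
by exists l; rewrite lt.
Qed.

(* By block_mean_types the choice of the realization is irrelevant; a type list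
   with too many points of some colour gets the junk value of [::]. *)
Definition type_mean g : R :=
  Phi (xget [::] [set l | uniq (pts l) /\ emap b l = g]%classic).

Lemma type_mean_emap l : uniq (pts l) -> type_mean (emap b l) = Phi l.
Proof.
move=> ul; rewrite /type_mean; case: xgetP => [l' _ [ul' bl']|/(_ l) []//].
exact: block_mean_types.
Qed.

Lemma type_mean_perm g g' : (forall c, ncol c g <= a c)%N -> perm_eq g g' ->
  type_mean g = type_mean g'.
Proof.
move=> ok gg'; have [l' [ul' bl']] : exists l, uniq (pts l) /\ emap b l = g'.
  by apply: realize_types => c; rewrite -(ncol_perm c gg').
case: l' ul' bl' => [|e l'] ul' bl'.
  by move: gg'; rewrite -bl' => /perm_nilP ->.
set L := e :: l' in ul' bl'.
have := gg'; rewrite -bl' => /(perm_iotaP (b e.1, b e.2))[Is Isp gE].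
pose l := [seq nth e L i | i <- Is].
have ll' : perm_eq l L.
  by apply/(perm_iotaP e); exists Is; rewrite // size_map in Isp *.
have bl : emap b l = g.
  rewrite gE /emap -map_comp; apply/eq_in_map => i iIs /=.
  apply: esym; apply: (@nth_map _ e _ (b e.1, b e.2) (fun e => (b e.1, b e.2)) i L).
  by move: iIs; rewrite (perm_mem Isp) mem_iota add0n size_map.
have ul : uniq (pts l) by rewrite (perm_uniq (perm_pts ll')).
by rewrite -bl !type_mean_emap // (block_mean_perm _ _ _ _ ll').
Qed.

Lemma type_mean_subseq g g' : (forall c, ncol c g' <= a c)%N -> subseq g g' ->
  type_mean g <= type_mean g' <= type_mean g + (size g' - size g)%N%:R.
Proof.
move=> /realize_types[l' [ul' <-]] /subseqP[m msz ->].
rewrite -map_mask -/(emap b _).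
have sl : subseq (mask m l') l' by exact: mask_subseq.
rewrite !type_mean_emap //; last exact: subseq_uniq (subseq_pts sl) ul'.
by rewrite !size_map; exact: block_mean_subseq.
Qed.

(** Monochromatic lists are determined up to order by their colour counts, so [g] is a rearranged
    sublist of the types of [l], and each missing edge lowers the maximum by at most one. *)
Lemma type_mean_local l g : uniq (pts l) -> all (fun e => b e.1 == b e.2) l ->
  all (fun x => x.1 == x.2) g -> (forall c, ncol c g <= ncol c (emap b l))%N ->
  Phi l <= type_mean g + (size l)%:R - (size g)%:R.
Proof.
move=> ul ll lg gl.
have llb : all (fun x => x.1 == x.2) (emap b l) by rewrite all_map.
have gC (c : C * C) : (count_mem c g <= count_mem c (emap b l))%N.
  have [cc|cc] := eqVneq c.1 c.2.
    case: c cc => c1 c2 /= <-; have := gl c1.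
    by rewrite !ncol_local// leq_double.
  rewrite (_ : count_mem c g = 0)%N //; apply/eqP; rewrite -leqn0 leqNgt -has_count.
  apply/negP => /hasP[x xg /eqP xc]; move/allP: lg => /(_ _ xg).
  by rewrite xc (negbTE cc).
have /count_subseqP[s sl gs] := gC.
have okl c : (ncol c (emap b l) <= a c)%N by rewrite -(card_free c ul) leq_addl.
have /andP[_] := type_mean_subseq okl sl.
rewrite type_mean_emap// => /le_trans; apply.
rewrite (type_mean_perm _ gs).
  rewrite natrB; last exact: size_subseq.
  by rewrite (perm_size gs) size_map; lra.
by move=> c; apply: leq_trans (gl c) (okl c).
Qed.

Lemma type_mean_convex c c' g k : (2 <= k)%N -> (forall c, ncol c g + k <= a c)%N ->
  type_mean ((c, c) :: g) + type_mean ((c', c') :: g) <=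
  2 * type_mean ((c, c') :: g) + 2 / k%:R.
Proof.
move=> k2 gk; have [<-|cc'] := eqVneq c c'.
  rewrite mulr_natl mulr2n lerDl divr_ge0//.
have [c0|l [ul lg]] := @realize_types g; first exact: leq_trans (leq_addr _ _) (gk c0).
have fk d : (k <= #|free_points b l d|)%N by have := card_free d ul; have := gk d; rewrite lg; lia.
have two d : exists u v, [/\ u \in free_points b l d, v \in free_points b l d & u != v].
  have /card_gt1P[u [v [? ? ?]]] : (1 < #|free_points b l d|)%N by apply: leq_trans (fk d).
  by exists u, v.
have [u1 [u2 [u1F u2F u12]]] := two c; have [v1 [v2 [v1F v2F v12]]] := two c'.
have uv : u1 != v1.
  apply: contra_neq cc' => uv; move: u1F v1F.
  by rewrite uv !finset.inE => /andP[/eqP-> _] /andP[/eqP-> _].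
have E d d' x y : x \in free_points b l d -> y \in free_points b l d' -> x != y ->
    type_mean ((d, d') :: g) = Phi ((x, y) :: l).
  move=> xF yF xy; rewrite -type_mean_emap; last exact: uniq_pts_cons ul xF yF xy.
  move: xF yF; rewrite !finset.inE => /andP[/eqP bx _] /andP[/eqP b_y _].
  by rewrite /= bx b_y -lg.
rewrite (E _ _ u1 u2)// (E _ _ v1 v2)// (E _ _ u1 v1)//.
exact: (block_mean_convex R col A0 ul (ltnW k2) (fk c) (fk c')).
Qed.

End TypeMean.

(** * Interpolation *)

(** [p] and [q] tell whether the ends of the replaced edge have the colour at hand; twice their sum
    pays for either replacement, which creates [2p] or [2q] points of that colour. *)
Lemma double_count_bound (p q : bool) (m n N : nat) :
  (n + (p + q + m).*2 <= N ->
   p + (p + n) + m.*2 <= N /\ q + (q + n) + m.*2 <= N)%N.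
Proof. by case: p; case: q; lia. Qed.

Lemma average_step (R : realFieldType) (X n0 u v S1 S2 S E p1 p2 p : R) :
  X + n0 - u - S1 <= p1 -> X + n0 - u - S2 <= p2 ->
  p1 + p2 <= 2 * (p + E + v) -> S1 + S2 + 2 * E <= 2 * S ->
  X + n0 - (u + v) - S <= p.
Proof. by lra. Qed.

Lemma error_sum (R : realFieldType) (X Y p n n' r u u' S S' : R) :
  X - n + n' - u' - S <= p -> p <= Y -> n <= n' + r -> u' <= u -> S <= S' ->
  X <= Y + r + u + S'.
Proof. by lra. Qed.

Lemma bounded_colour_double (u v M k : nat) :
  (v <= u - k -> u <= M.*2 -> 0 + v.*2 <= 4 * M)%N.
Proof. by lia. Qed.

Lemma bounded_colour_weight (u v M k : nat) :
  (v <= u - k -> u <= M.*2 -> (4 * M + 1) * v + 4 * M <= 4 * M * (2 * M + 2))%N.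
Proof. by nia. Qed.

Section Interpolation.
Variables (R : realType) (P I C : finType) (A : {set I}) (col : I -> P -> bool).
Variable b : P -> C.
Hypothesis A0 : A != finset.set0.
Variables (M k : nat).
Hypothesis k2 : (2 <= k)%N.
Hypothesis kM : (k <= M)%N.
Hypothesis blockM : forall c, (M <= block_size b c <= M.*2)%N.
Implicit Types (l : seq (P * P)) (g o : seq (C * C)).
Local Notation a := (block_size b).
Local Notation Phi := (block_mean R A col b).
Local Notation Tmean := (type_mean R A col b).

(** Staying [k] points below the block size leaves room for one more edge of any type and provides
    the free points that [type_mean_convex] needs. *)
Let cap c : nat := a c - k.

Let good g (x : C * C) := (ncol x.1 g <= cap x.1)%N && (ncol x.2 g <= cap x.2)%N.

Let keep g := [seq x <- g | good g x].

(* Edges meeting an overfull colour are discarded, so that every type list has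
   a mean value; this keeps at least k points of each colour unused. *)
Let psi g : R := Tmean (keep g).

Let capk c : (cap c + k <= a c)%N.
Proof. by have := blockM c; rewrite /cap; lia. Qed.

Let ncol_keep c g : (ncol c (keep g) <= cap c)%N.
Proof.
have [ok|bad] := leqP (ncol c g) (cap c).
  by apply: leq_trans (ncol_subseq c (filter_subseq _ _)) ok.
suff -> : ncol c (keep g) = 0%N by [].
have nx x : x \in keep g -> (x.1 != c) && (x.2 != c).
  rewrite mem_filter /good => /andP[/andP[h1 h2] _].
  by apply/andP; split; [apply: contraTneq h1|apply: contraTneq h2] => ->; rewrite -ltnNge.
elim: (keep g) nx => [|x h IH] nx //; rewrite ncol_cons IH; last first.
  by move=> y yh; apply: nx; rewrite inE yh orbT.
by have /andP[/negbTE -> /negbTE ->] := nx x (mem_head _ _).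
Qed.

Let keep_ok c g : (ncol c (keep g) <= a c)%N.
Proof. by have := ncol_keep c g; have := capk c; lia. Qed.

Let cons_keep_ok c x g : (ncol c (x :: keep g) <= a c)%N.
Proof.
rewrite ncol_cons; have := ncol_keep c g; have := capk c.
by case: (x.1 == c); case: (x.2 == c); lia.
Qed.

Let psi_perm g g' : perm_eq g g' -> psi g = psi g'.
Proof.
move=> gg'; apply: type_mean_perm; first by move=> c; exact: keep_ok.
rewrite /keep (eq_filter (a2 := good g')); first exact: perm_filter.
by move=> x; rewrite /good !(ncol_perm _ gg').
Qed.

(** One further edge may bring two points of colour [c], hence the margin [2]. *)
Let full c g := (cap c < ncol c g + 2)%N.

Let filter_cons (T : Type) (Q : pred T) x s :
  [seq y <- x :: s | Q y] =
  if Q x then x :: [seq y <- s | Q y] else [seq y <- s | Q y].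
Proof. by []. Qed.

Let keep_cons_subseq x g : subseq (keep (x :: g)) (x :: keep g).
Proof.
have sub y : good (x :: g) y -> good g y.
  rewrite /good !ncol_cons => /andP[h1 h2].
  by apply/andP; split; apply: leq_trans (leq_addl _ _) _; [exact: h1|exact: h2].
have S : subseq [seq y <- g | good (x :: g) y] (keep g).
  rewrite subseq_filter filter_subseq andbT.
  by apply/allP => y; rewrite mem_filter => /andP[/sub].
rewrite {1}/keep filter_cons; case: ifP => _; first by rewrite /= eqxx.
exact: subseq_trans S (subseq_cons _ _).
Qed.

Let keep_cons x g : ~~ full x.1 g -> ~~ full x.2 g -> keep (x :: g) = x :: keep g.
Proof.
rewrite /full -!leqNgt => h1 h2.
have gx : good (x :: g) x.
  rewrite /good !ncol_cons !eqxx.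
  by case: (x.1 == x.2); case: (x.2 == x.1); lia.
rewrite /keep /= gx; congr (_ :: _); apply: eq_filter => y; rewrite /good !ncol_cons.
have cap_eq c : ((x.1 == c) + (x.2 == c) + ncol c g <= cap c)%N = (ncol c g <= cap c)%N.
  have [e1|_] := eqVneq x.1 c; have [e2|_] := eqVneq x.2 c => //;
    apply/idP/idP; move: h1 h2; rewrite ?e1 ?e2; lia.
by rewrite !cap_eq.
Qed.

(** Only edges sharing a colour with [x] can become bad; the capacities of its two colours, at most
    [2M] each, bound their number. *)
Let size_keep_cons x g : (size (keep g) <= size (keep (x :: g)) + 4 * M)%N.
Proof.
set h := [seq y <- keep g | [&& y.1 != x.1, y.1 != x.2, y.2 != x.1 & y.2 != x.2]].
have hs : subseq h (keep (x :: g)).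
  rewrite /h /keep /=; set s := [seq y <- g | good (x :: g) y].
  apply: (@subseq_trans _ s); last by case: ifP => // _; exact: subseq_cons.
  rewrite -filter_predI subseq_filter filter_subseq andbT; apply/allP => y.
  rewrite mem_filter /= => /andP[/andP[/and4P[n1 n2 n3 n4] gy] _].
  move: gy; rewrite /good !ncol_cons.
  by rewrite ![x.1 == _]eq_sym ![x.2 == _]eq_sym (negbTE n1) (negbTE n2) (negbTE n3) (negbTE n4).
have := size_avoid x.1 x.2 (keep g); rewrite -/h.
have := size_subseq hs; have := ncol_keep x.1 g; have := ncol_keep x.2 g.
have := capk x.1; have := capk x.2; have := blockM x.1; have := blockM x.2.
move: (cap _) (cap _) (a _) (a _) (ncol _ _) (ncol _ _) (size _) (size _) (size _).
by move=> ? ? ? ? ? ? ? ? ?; lia.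
Qed.

Let psi_cons_le x g : psi (x :: g) <= Tmean (x :: keep g).
Proof.
have ok c := cons_keep_ok c x g.
by have /andP[] := type_mean_subseq R A col ok (keep_cons_subseq x g).
Qed.

(** Discarding commutes with adding [x] unless a colour of [x] is full; in that case at most [4M]
    kept edges and [x] itself disappear. *)
Let psi_cons_ge x g : Tmean (x :: keep g) <=
  psi (x :: g) + (4 * M + 1)%N%:R * ((full x.1 g)%:R + (full x.2 g)%:R).
Proof.
have [|] := boolP (~~ full x.1 g && ~~ full x.2 g).
  case/andP => h1 h2; rewrite /psi (keep_cons h1 h2) (negbTE h1) (negbTE h2).
  by rewrite addr0 mulr0 addr0.
rewrite negb_and !negbK => h.
have ok c := cons_keep_ok c x g.
have /andP[_] := type_mean_subseq R A col ok (keep_cons_subseq x g).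
move=> /le_trans; apply; rewrite lerD2l.
apply: le_trans (_ : (4 * M + 1)%N%:R * 1 <= _).
  rewrite mulr1 ler_nat; have := size_keep_cons x g; rewrite /=; lia.
rewrite ler_wpM2l//.
by case/orP: h => ->; rewrite ?lerDl ?lerDr ler0n.
Qed.

Let psi_convex c c' g : psi ((c, c) :: g) + psi ((c', c') :: g) <=
  2 * (psi ((c, c') :: g) + (4 * M + 1)%N%:R * ((full c g)%:R + (full c' g)%:R)
       + k%:R^-1).
Proof.
apply: le_trans (lerD (psi_cons_le _ _) (psi_cons_le _ _)) _.
have gk d : (ncol d (keep g) + k <= a d)%N.
  by have := ncol_keep d g; have := capk d; lia.
apply: le_trans (type_mean_convex R col A0 c c' k2 gk) _.
rewrite -mulrDr ler_pM2l// lerD2r; exact: (psi_cons_ge (c, c')).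
Qed.

(** Thinning to [a c - 2k] leaves a gap [k] below [cap c], the room in which the random colour
    counts may fluctuate. *)
Lemma subseq_pick (l : seq (P * P)) : exists2 l', subseq l' l &
  (forall c, ncol c (emap b l') <= a c - k.*2)%N /\
  (uniq (pts l) -> size l <= size l' + k.*2 * #|C|)%N.
Proof.
have [l' sl [lc sz]] := exists_bounded_subseq b (fun c => a c - k.*2)%N l.
exists l' => //; split=> // ul; apply: leq_trans sz _; rewrite leq_add2l.
rewrite mulnC -sum_nat_const; apply: leq_sum => c _.
by rewrite -(card_free b c ul); move: #|_| (ncol _ _) => u v; lia.
Qed.

Variable s : R.
Hypothesis s0 : 0 <= s.
Let z := 1 + s.
(** The mean of [z] to the number of points of [c] created when an edge with one end of colour [c]
    is replaced: two or none, by a fair coin. *)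
Let q := (1 + z ^+ 2) / 2.

Let z1 : 1 <= z. Proof. by rewrite /z lerDl. Qed.
Let z0 : 0 < z. Proof. exact: lt_le_trans ltr01 z1. Qed.
Let zq : z <= q.
Proof. by rewrite /q ler_pdivlMr//; have := sqr_ge0 (z - 1); rewrite sqrrB expr1n; lra. Qed.
Let q1 : 1 <= q. Proof. exact: le_trans z1 zq. Qed.
Let q0 : 0 < q. Proof. exact: lt_le_trans ltr01 q1. Qed.

(* Dominates the probability that colour c overflows, once each edge of gs has
   been replaced by a monochromatic one of either of its two colours. *)
Let pot c gs o : R := q ^+ ncol c gs * z ^+ ncol c o / z ^+ (cap c).-1.

Let pot_ge0 c gs o : 0 <= pot c gs o.
Proof. by rewrite mulr_ge0 ?invr_ge0 ?mulr_ge0 ?exprn_ge0 // ltW. Qed.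

(** Markov's inequality in exponential form: a full colour has at least [cap c - 1] points, and
    [z <= q] allows the points of [gs] to count with base [q]. *)
Let full_pot c gs o : (full c (gs ++ o))%:R <= pot c gs o.
Proof.
rewrite /full; case: ltnP => [h|_]; last exact: pot_ge0.
rewrite /pot ler_pdivlMr ?exprn_gt0// mul1r.
apply: le_trans (_ : z ^+ (ncol c gs + ncol c o) <= _).
  by rewrite ler_weXn2l//; move: h; rewrite ncol_cat; lia.
by rewrite exprD ler_wpM2r ?exprn_ge0 ?(ltW z0)// lerXn2r ?nnegrE ?(ltW z0) ?(ltW q0).
Qed.

Let pot_cons c x gs o : pot c gs o <= pot c (x :: gs) o.
Proof.
rewrite /pot ncol_cons exprD -!mulrA ler_peMl ?exprn_ege1//.
by rewrite mulr_ge0 ?mulr_ge0 ?invr_ge0 ?exprn_ge0 ?ltW.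
Qed.

(** The potential is a supermartingale under the fair coin. One end of colour [c] gives equality by
    the choice of [q]; two ends need [z^2 <= q^2]. *)
Let pot_step c x gs o :
  pot c gs ((x.1, x.1) :: o) + pot c gs ((x.2, x.2) :: o) <= 2 * pot c (x :: gs) o.
Proof.
rewrite /pot !ncol_cons /= !exprD.
set u := q ^+ ncol c gs; set v := z ^+ ncol c o; set w := (z ^+ _)^-1.
have uvw : 0 <= u * v * w by rewrite !mulr_ge0 ?invr_ge0 ?exprn_ge0 ?ltW.
rewrite (_ : _ + _ = (z ^+ (x.1 == c) ^+ 2 + z ^+ (x.2 == c) ^+ 2) * (u * v * w)); last by ring.
rewrite (_ : 2 * _ = 2 * (q ^+ (x.1 == c) * q ^+ (x.2 == c)) * (u * v * w)); last by ring.
rewrite ler_wpM2r//.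
have qE : 2 * q = 1 + z ^+ 2 by rewrite /q; lra.
case: (x.1 == c); case: (x.2 == c); rewrite ?expr1 ?expr0 ?expr1n ?mulr1 ?mul1r; try lra.
have : z ^+ 2 <= q * q by rewrite expr2 ler_pM ?(ltW z0).
lra.
Qed.

(* The edges of o have already been replaced by monochromatic ones, those of gs
   not yet. *)
Lemma interpolation_induction (lloc : seq (P * P)) gs o :
  uniq (pts lloc) -> all (fun e => b e.1 == b e.2) lloc ->
  (forall c, ncol c (emap b lloc) = a c) ->
  all (fun x => x.1 == x.2) o ->
  (forall c, ncol c o + (ncol c gs).*2 <= 4 * M)%N ->
  Phi lloc - (size lloc)%:R + (size gs + size o)%N%:R - (size gs)%:R / k%:R
    - \sum_c ((4 * M + 1)%N%:R * (ncol c gs)%:R + (4 * M)%N%:R) * pot c gs o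
  <= psi (gs ++ o).
Proof.
move=> ul ll lc; elim: gs o => [|x gs IH] o oloc oM.
  rewrite mul0r subr0 /=.
  have kl : all (fun x => x.1 == x.2) (keep o).
    by apply/allP => y; rewrite mem_filter => /andP[_]; move/allP: oloc; apply.
  have kc c : (ncol c (keep o) <= ncol c (emap b lloc))%N by rewrite lc.
  have := type_mean_local R A col ul ll kl kc; rewrite -/(psi o).
  (* No edge is left to replace. A discarded edge meets an overfull colour, which has at most [4M]
     points in [o] and potential at least one; this is the term [4M] of the weight. *)
  have : (size o)%:R <= (size (keep o))%:R +
      \sum_c ((4 * M + 1)%N%:R * 0%:R + (4 * M)%N%:R) * pot c [::] o.
    have szo : (size o <= size (keep o) + \sum_(c | (cap c < ncol c o)%N) ncol c o)%N.
      rewrite -(count_predC (good o) o) size_filter leq_add2l.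
      apply: leq_trans (count_touching _ o); apply: sub_count => y /=.
      by rewrite /good negb_and -!ltnNge.
    apply: le_trans (_ : (size (keep o) + \sum_(c | (cap c < ncol c o)%N) ncol c o)%N%:R <= _).
      by rewrite ler_nat.
    rewrite natrD lerD2l natr_sum big_mkcond; apply: ler_sum => c _.
    rewrite mulr0 add0r; case: ifP => [h|_]; last by rewrite mulr_ge0.
    apply: le_trans (_ : (4 * M)%N%:R * 1 <= _).
      by rewrite mulr1 ler_nat; exact: leq_trans (leq_addr _ _) (oM c).
    rewrite ler_wpM2l//; apply: le_trans (full_pot c [::] o).
    by rewrite /full (ltn_addr 2 h).
  by rewrite add0n; lra.
pose o1 := (x.1, x.1) :: o; pose o2 := (x.2, x.2) :: o.
have oM' y c : (y = x.1) \/ (y = x.2) -> (ncol c ((y, y) :: o) + (ncol c gs).*2 <= 4 * M)%N.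
  have := oM c; rewrite !ncol_cons /= => /double_count_bound; rewrite !addnA => -[h1 h2].
  by case=> ->.
have l1 : all (fun x => x.1 == x.2) o1 by rewrite /= eqxx.
have l2 : all (fun x => x.1 == x.2) o2 by rewrite /= eqxx.
have I1 := IH o1 l1 (fun c => oM' _ c (or_introl erefl)).
have I2 := IH o2 l2 (fun c => oM' _ c (or_intror erefl)).
have p1 : psi (gs ++ o1) = psi ((x.1, x.1) :: (gs ++ o)).
  by apply: psi_perm; rewrite (perm_catCA gs [:: (x.1, x.1)] o).
have p2 : psi (gs ++ o2) = psi ((x.2, x.2) :: (gs ++ o)).
  by apply: psi_perm; rewrite (perm_catCA gs [:: (x.2, x.2)] o).
have cv := psi_convex x.1 x.2 (gs ++ o).
rewrite -p1 -p2 -surjective_pairing in cv.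
set L : R := (4 * M + 1)%N%:R in I1 I2 cv *.
set N4 : R := (4 * M)%N%:R in I1 I2 *.
have L0 : 0 <= L by exact: ler0n.
set S1 := (X in _ - X <= _) in I1; set S2 := (X in _ - X <= _) in I2.
set S := (X in _ - X <= _).
(* The replacement may cost [4M + 1] at each full end of [x]. The weight [(4M + 1) * ncol] pays for
   it, as it loses one unit per end when [x] leaves the list. *)
have main : S1 + S2 + 2 * (L * ((full x.1 (gs ++ o))%:R + (full x.2 (gs ++ o))%:R)) <= 2 * S.
  have -> : S = \sum_c (L * (ncol c gs)%:R + N4) * pot c (x :: gs) o +
       (L * pot x.1 (x :: gs) o + L * pot x.2 (x :: gs) o).
    have D y : L * pot y (x :: gs) o =
        \sum_c (L * (y == c)%:R) * pot c (x :: gs) o.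
      rewrite (bigD1 y) //= eqxx mulr1 big1 ?addr0// => c cy.
      by rewrite eq_sym (negbTE cy) mulr0 mul0r.
    rewrite !D -!big_split /=; apply: eq_bigr => c _.
    by rewrite ncol_cons !natrD; ring.
  rewrite [leRHS]mulrDr lerD//.
    rewrite /S1 /S2 -big_split mulr_sumr; apply: ler_sum => c _ /=.
    rewrite -mulrDr mulrCA ler_wpM2l ?addr_ge0 ?mulr_ge0 ?ler0n//.
    exact: pot_step.
  rewrite ler_pM2l// -mulrDr ler_wpM2l// lerD//.
    by apply: le_trans (full_pot _ gs o) (pot_cons _ _ _ _).
  by apply: le_trans (full_pot _ gs o) (pot_cons _ _ _ _).
have -> : (size (x :: gs) + size o = size gs + size o1)%N by rewrite /= addSnnS.
have -> : (size (x :: gs))%:R / k%:R = (size gs)%:R / k%:R + k%:R^-1 :> R.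
  by rewrite /= -natr1 mulrDl mul1r.
exact: average_step I1 I2 cv main.
Qed.

(** The three errors are the thinning, the diagonal cost [1 / k] per edge, and the potential at the
    start, when no edge has been replaced. *)
Lemma interpolation_bound (l lloc : seq (P * P)) :
  uniq (pts l) -> uniq (pts lloc) -> size lloc = size l ->
  all (fun e => b e.1 == b e.2) lloc ->
  (forall c, ncol c (emap b lloc) = a c) ->
  Phi lloc <= Phi l + (k.*2 * #|C|)%N%:R + (size l)%:R / k%:R +
    \sum_c (4 * M * (2 * M + 2))%N%:R * (q ^+ (a c - k.*2) / z ^+ (cap c).-1).
Proof.
move=> ul ull sz ll lc.
have [l' sl [lk sz']] := subseq_pick l; have {}sz' := sz' ul.
have ul' : uniq (pts l') by exact: subseq_uniq (subseq_pts sl) ul.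
have oM c : (ncol c [::] + (ncol c (emap b l')).*2 <= 4 * M)%N.
  by have /andP[_] := blockM c; exact: (bounded_colour_double (lk c)).
have := @interpolation_induction lloc (emap b l') [::] ull ll lc isT oM.
rewrite cats0 addn0 => h.
have h1 : psi (emap b l') <= Phi l.
  have ok c : (ncol c (emap b l') <= a c)%N by exact: leq_trans (lk c) (leq_subr _ _).
  have /andP[+ _] := type_mean_subseq R A col ok (filter_subseq (good (emap b l')) _).
  rewrite (type_mean_emap _ _ _ _ ul') => /le_trans; apply.
  by have /andP[] := block_mean_subseq R A col b sl.
have h2 : (size l)%:R <= (size l')%:R + (k.*2 * #|C|)%N%:R :> R by rewrite -natrD ler_nat.
have h3 : (size l')%:R / k%:R <= (size l)%:R / k%:R :> R.
  by rewrite ler_wpM2r ?invr_ge0// ler_nat size_subseq.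
set S := (X in _ - X <= _) in h.
have : S <= \sum_c (4 * M * (2 * M + 2))%N%:R * (q ^+ (a c - k.*2) / z ^+ (cap c).-1).
  apply: ler_sum => c _.
  apply: ler_pM; rewrite ?pot_ge0 ?addr_ge0 ?mulr_ge0 ?ler0n//.
    rewrite -natrM -natrD ler_nat.
    by have /andP[_] := blockM c; exact: (bounded_colour_weight (lk c)).
  rewrite /pot /ncol /= expr0 mulr1 ler_wpM2r ?invr_ge0 ?exprn_ge0 ?(ltW z0)//.
  by apply: ler_weXn2l => //; exact: lk.
rewrite sz in h; rewrite size_map in h.
move=> S_le; exact: error_sum h h1 h2 h3 S_le.
Qed.

End Interpolation.

(** * Choice of the parameters of the interpolation *)

Section InterpolationLimit.
Variable R : realType.

Lemma expR_ge_sqr (x : R) : 0 <= x -> x ^+ 2 / 4 <= expR x.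
Proof.
move=> x0; have -> : expR x = expR (x / 2) ^+ 2 by rewrite expr2 -expRD; congr expR; lra.
have -> : x ^+ 2 / 4 = (x / 2) ^+ 2 by field.
rewrite lerXn2r ?nnegrE ?expR_ge0//; first by lra.
by apply: le_trans (expR_ge1Dx _); rewrite lerDr.
Qed.

Lemma expRN_le (x : R) : 0 < x -> expR (- x) <= 4 / x ^+ 2.
Proof.
move=> x0; rewrite expRN -[leRHS]invrK lef_pV2 ?posrE ?expR_gt0//.
  by rewrite invf_div; apply: expR_ge_sqr; exact: ltW.
by rewrite invr_gt0 divr_gt0 // exprn_gt0.
Qed.

(** With [s = d / 6], [q <= expR (s + s^2 / 2)] and [1 / z <= expR (- (s - s^2))]. The gap [k] makes
    the linear terms at most [- s d M], the quadratic ones are at most [3 s^2 M], and this [s]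
    minimises the sum, with value [- d^2 M / 12]. *)
Lemma overflow_bound (d : R) (M k a : nat) : 0 < d -> d <= 1 ->
  d * M%:R + 1 <= k%:R -> (k.*2 < a)%N -> (a <= M.*2)%N ->
  ((1 + (1 + d / 6) ^+ 2) / 2) ^+ (a - k.*2) / (1 + d / 6) ^+ (a - k).-1 <=
  expR (- (d ^+ 2 * M%:R / 12)).
Proof.
move=> d0 d1 kd ka aM; set s := d / 6.
have s0 : 0 < s by rewrite divr_gt0.
have s1 : s <= 1 / 6 by rewrite /s; lra.
have s2 : s ^+ 2 <= s / 6 by rewrite expr2 -(mulr1 (s / 6)) -mulrA ler_pM2l//; lra.
have hq : (1 + (1 + s) ^+ 2) / 2 <= expR (s + s ^+ 2 / 2).
  apply: le_trans (expR_ge1Dx _); rewrite sqrrD; lra.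
have hz : (1 + s)^-1 <= expR (- (s - s ^+ 2)).
  apply: le_trans (expR_ge1Dx _); rewrite -[leLHS]div1r ler_pdivrMr ?addr_gt0//.
  have -> : (1 + - (s - s ^+ 2)) * (1 + s) = 1 + s ^+ 3 by ring.
  by rewrite lerDl exprn_ge0// ltW.
have -> : ((1 + s) ^+ (a - k).-1)^-1 = (1 + s)^-1 ^+ (a - k).-1 by rewrite exprVn.
apply: le_trans (_ : expR (s + s ^+ 2 / 2) ^+ (a - k.*2) *
    expR (- (s - s ^+ 2)) ^+ (a - k).-1 <= _).
  apply: ler_pM; rewrite ?exprn_ge0// ?invr_ge0 ?lerXn2r ?nnegrE ?expR_ge0 ?invr_ge0//;
    try (by rewrite ?divr_ge0 ?addr_ge0 ?sqr_ge0 // ltW).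
rewrite -!expRM_natl -expRD ler_expR.
have -> : (a - k.*2)%N%:R = a%:R - 2 * k%:R :> R.
  by rewrite natrB ?(ltnW ka)// -mul2n natrM.
have -> : (a - k).-1%:R = a%:R - k%:R - 1 :> R.
  by rewrite -subn1 natrB ?natrB//; lia.
have aR : a%:R <= 2 * M%:R :> R by rewrite -natrM ler_nat; lia.
have M0 : (0 : R) <= M%:R by exact: ler0n.
have -> : (a%:R - 2 * k%:R) * (s + s ^+ 2 / 2) + (a%:R - k%:R - 1) * - (s - s ^+ 2) =
    s * (1 - k%:R) + s ^+ 2 * (3 / 2 * a%:R) - s ^+ 2 * (2 * k%:R + 1) by field.
have h1 : s * (1 - k%:R) <= s * (- (d * M%:R)) by rewrite ler_pM2l//; lra.
have h2 : s ^+ 2 * (3 / 2 * a%:R) <= s ^+ 2 * (3 * M%:R).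
  by rewrite ler_wpM2l ?sqr_ge0//; lra.
have h3 : 0 <= s ^+ 2 * (2 * k%:R + 1) by rewrite mulr_ge0 ?sqr_ge0// addr_ge0// mulr_ge0.
have -> : - (d ^+ 2 * M%:R / 12) = s * (- (d * M%:R)) + s ^+ 2 * (3 * M%:R).
  by rewrite /s; field.
lra.
Qed.

Lemma quadratic_weight (M : nat) : (8 < M -> 4 * M * (2 * M + 2) <= 16 * M ^ 2)%N.
Proof. by nia. Qed.

Lemma interpolation_error (e : R) : 0 < e -> exists M0 : nat,
  forall M : nat, (M0 <= M)%N -> exists k : nat,
  [/\ (2 <= k)%N, (k.*2 < M)%N &
    2 * k%:R + M%:R / (2 * k%:R) + (4 * M * (2 * M + 2))%N%:R *
    expR (- ((Num.min 1 e / 16) ^+ 2 * M%:R / 12)) <= e * M%:R /\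
    Num.min 1 e / 16 * M%:R + 1 <= k%:R].
Proof.
move=> e0; set d := Num.min 1 e / 16.
have me : 0 < Num.min 1 e by rewrite lt_min ltr01.
have d0 : 0 < d by rewrite divr_gt0.
have d1 : d <= 1 / 16 by rewrite ler_pM2r ?invr_gt0// ge_min lexx.
have d2 : d <= e / 16 by rewrite ler_pM2r ?invr_gt0// ge_min lexx orbT.
(* [K] collects what stays bounded as [M] grows: the diagonal term [M / (2k)], the overflow term
   through [expR (- x) <= 4 / x^2] at [x = d^2 M / 12], and an additive constant. *)
pose K := 6 + (2 * d)^-1 + 16 * (4 * (12 * 12)) / d ^+ 4.
have [M0 hM0] : exists M0 : nat, 2 * K / e + 8 < M0%:R.
  exists (Num.truncn (2 * K / e + 8)).+1; exact: truncnS_gt.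
exists M0 => M MM0.
have MM : 2 * K / e + 8 < M%:R by apply: lt_le_trans hM0 _; rewrite ler_nat.
have K0 : 0 < K.
  have K1 : 0 < (2 * d)^-1 by rewrite invr_gt0 mulr_gt0.
  have K2 : 0 < 16 * (4 * (12 * 12)) / d ^+ 4 by rewrite divr_gt0 ?exprn_gt0 ?mulr_gt0.
  by apply: addr_gt0 => //; apply: addr_gt0.
have M8 : 8 < M%:R :> R by apply: le_lt_trans MM; rewrite lerDr divr_ge0 ?mulr_ge0 ?ltW.
have M_gt0 : 0 < M%:R :> R by lra.
have KM : 2 * K <= e * M%:R.
  rewrite -ler_pdivrMl// mulrC; apply: le_trans (ltW MM); rewrite mulrC.
  by rewrite [e^-1 * _]mulrC lerDl.
pose k := (Num.truncn (d * M%:R)).+2.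
have dM0 : 0 <= d * M%:R by rewrite mulr_ge0// ltW.
have k1 : d * M%:R + 1 <= k%:R.
  by rewrite /k -natr1 lerD2r ltW// truncnS_gt.
have k2 : k%:R <= d * M%:R + 2.
  by rewrite /k -addn2 natrD lerD2r truncn_le.
have dM : d * M%:R <= M%:R / 16 by rewrite mulrC ler_pM2l//; lra.
exists k; split => //; first by rewrite -(ltr_nat R) -mul2n natrM; lra.
split => //.
have k0 : 0 < k%:R :> R by rewrite ltr0n.
have p1 : M%:R / (2 * k%:R) <= (2 * d)^-1.
  rewrite ler_pdivrMr ?mulr_gt0// [leRHS]mulrC ler_pdivlMr ?mulr_gt0//; lra.
have p2 : (4 * M * (2 * M + 2))%N%:R * expR (- (d ^+ 2 * M%:R / 12)) <= 16 * (4 * (12 * 12)) / d ^+ 4.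
  apply: le_trans (_ : 16 * M%:R ^+ 2 * (4 / (d ^+ 2 * M%:R / 12) ^+ 2) <= _).
    apply: ler_pM; rewrite ?expR_ge0//; last first.
      by apply: expRN_le; rewrite divr_gt0 ?mulr_gt0 ?exprn_gt0.
    rewrite -natrX -natrM ler_nat; apply: quadratic_weight.
    by rewrite -(ltr_nat R).
  rewrite le_eqVlt; apply/orP; left; apply/eqP; field.
  by rewrite !gt_eqF.
have p3 : 2 * k%:R <= e * M%:R / 8 + 4.
  apply: le_trans (_ : 2 * (d * M%:R + 2) <= _); first by rewrite ler_pM2l.
  have : d * M%:R <= e / 16 * M%:R by rewrite ler_pM2r.
  lra.
have y0 : 0 <= e * M%:R by rewrite mulr_ge0 ?ltW.
have sum3 (x x' u u' v y : R) : 0 <= y -> x <= x' -> u <= u' ->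
    v <= y / 8 + 4 -> 2 * (6 + x' + u') <= y -> v + x + u <= y by lra.
exact: sum3 y0 p1 p2 p3 KM.
Qed.

(** [M0] depends on [e] alone, so the inequality holds for every pairing [l] at once and can later
    be averaged over it. *)
Theorem interpolation (e : R) : 0 < e -> exists M0 : nat,
  forall M : nat, (M0 <= M)%N ->
  forall (P I C : finType) (A : {set I}) (col : I -> P -> bool) (b : P -> C)
    (l lloc : seq (P * P)),
  A != finset.set0 -> (forall c, M <= block_size b c <= M.*2)%N ->
  perm_eq (pts l) (enum P) -> perm_eq (pts lloc) (enum P) ->
  all (fun x => b x.1 == b x.2) lloc ->
  block_mean R A col b lloc <= block_mean R A col b l + e * #|P|%:R.
Proof.
move=> e0; have [M0 hM0] := interpolation_error e0.
exists M0 => M /hM0[k [k2 kM [err dk]]] P I C A col b l lloc A0 blockM pl plloc loc.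
have kleM : (k <= M)%N by apply: leq_trans (ltnW kM); rewrite -addnn leq_addl.
have cntP (T : finType) (f : T -> C) (c : C) t :
    perm_eq t (enum T) -> count (fun x => f x == c) t = #|[set x | f x == c]|.
  move=> /seq.permP ->; rewrite -size_filter cardE; congr size.
  by rewrite [RHS]/enum_mem /= -enumT; apply: eq_filter => x; rewrite [RHS]inE.
have ul : uniq (pts l) by rewrite (perm_uniq pl) enum_uniq.
have ull : uniq (pts lloc) by rewrite (perm_uniq plloc) enum_uniq.
have szl : (size l).*2 = #|P| by rewrite -size_pts (perm_size pl) cardE.
have szll : (size lloc).*2 = #|P| by rewrite -size_pts (perm_size plloc) cardE.
have sz : size lloc = size l by apply: double_inj; rewrite szl.
have lc c : ncol c (emap b lloc) = block_size b c by rewrite ncol_emap cntP.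
(* This turns an error per colour into an error per point, with a factor [1 / M]. *)
have CP : (#|C| * M <= #|P|)%N.
  rewrite -[#|P|]cardsT -sum1_card (partition_big b predT) //=.
  rewrite -sum_nat_const; apply: leq_sum => c _; have /andP[+ _] := blockM c.
  move/leq_trans; apply; rewrite /block_size -sum1_card leq_eqVlt; apply/orP; left.
  by apply/eqP; apply: eq_bigl => x; rewrite !finset.inE.
pose d := Num.min 1 e / 16.
have d0 : 0 < d by rewrite divr_gt0// lt_min ltr01.
have d1 : d <= 1.
  by rewrite ler_pdivrMr// mul1r ge_min; apply/orP; left; lra.
have := @interpolation_bound R P I C A col b A0 M k k2 _ blockM (d / 6) _ l lloc ul ull sz loc lc.
have k0 : (0 : R) < k%:R by rewrite ltr0n; exact: ltnW k2.
move=> /(_ kleM ltac:(by rewrite divr_ge0// ltW)) /le_trans; apply.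
rewrite -!addrA lerD2l.
set p := expR (- (d ^+ 2 * M%:R / 12)).
have M0' : (0 : R) < M%:R by rewrite ltr0n; exact: leq_ltn_trans (leq0n _) kM.
apply: le_trans (_ : #|C|%:R * (2 * k%:R) + (#|P|%:R / (2 * k%:R) +
    #|C|%:R * ((4 * M * (2 * M + 2))%N%:R * p)) <= _).
  rewrite lerD// ?lerD//.
  - by rewrite -!natrM ler_nat -mul2n mulnC.
  - by rewrite -szl -mul2n natrM -mulf_div divff ?mul1r// pnatr_eq0.
  - rewrite mulr_natl -sumr_const; apply: ler_sum => c _.
    rewrite ler_wpM2l//; have /andP[aM1 aM2] := blockM c.
    by apply: overflow_bound => //; exact: leq_trans kM aM1.
have CPR : #|C|%:R * M%:R <= #|P|%:R :> R by rewrite -natrM ler_nat.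
rewrite -(ler_pM2r M0').
apply: le_trans (_ : #|P|%:R * (2 * k%:R + M%:R / (2 * k%:R) +
    (4 * M * (2 * M + 2))%N%:R * p) <= _).
  set u := (4 * M * _)%N%:R * p.
  have u0 : 0 <= u by rewrite mulr_ge0 ?expR_ge0.
  have h1 := ler_wpM2r u0 CPR.
  have h2 : #|C|%:R * M%:R * (2 * k%:R) <= #|P|%:R * (2 * k%:R) :> R.
    by rewrite ler_wpM2r// mulr_ge0.
  lra.
by rewrite [e * _]mulrC -mulrA ler_wpM2l.
Qed.

End InterpolationLimit.

(** * Configurations and their graphs *)

(** Exchanging the values [x] and [y] touches at most the two edges carrying them, and every edge
    changes the maximum by at most one. *)
Lemma maxsep_tperm_lipschitz (R : realType) (P I : finType) (A : {set I})
    (col : I -> P -> bool) (l : seq (P * P)) : uniq (pts l) ->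
  tperm_lipschitz 2 (fun s : {perm P} => (maxsep A col (emap s l))%:R : R).
Proof.
move=> ul s x y.
pose Q (e : P * P) := [&& s e.1 != x, s e.1 != y, s e.2 != x & s e.2 != y].
pose l' := [seq e <- l | Q e].
have l'l : subseq l' l by exact: filter_subseq.
have sz : (size l <= size l' + 2)%N.
  have u : uniq (pts (emap s l)) by rewrite pts_emap map_inj_uniq//; exact: perm_inj.
  have := size_avoid x y (emap s l); rewrite /emap filter_map !size_map -/l' -/(emap s l).
  rewrite /ncol !(count_uniq_mem _ u) => /leq_trans; apply.
  by rewrite -addnA leq_add2l; case: (x \in _); case: (y \in _).
have E : emap (s * tperm x y)%g l' = emap s l'.
  apply/eq_in_map => e; rewrite mem_filter => /andP[/and4P[h1 h2 h3 h4] _].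
  by rewrite !permM !tpermD // eq_sym.
have B (t : {perm P}) : (maxsep A col (emap t l') <= maxsep A col (emap t l)
    <= maxsep A col (emap t l') + 2)%N.
  have sub : subseq (emap t l') (emap t l) by exact: map_subseq.
  rewrite maxsep_subseq //= (leq_trans (maxsep_size A col sub)) // leq_add2l.
  by rewrite !size_map leq_subLR.
have := B s; have := B (s * tperm x y)%g; rewrite E.
set u := maxsep _ _ (emap s l'); set v := maxsep _ _ (emap s l).
set w := maxsep _ _ _ => /andP[h3 h4] /andP[h1 h2].
have h5 : v%:R <= w%:R + 2%:R :> R by rewrite -natrD ler_nat (leq_trans h2) // leq_add2r.
have h6 : w%:R <= v%:R + 2%:R :> R by rewrite -natrD ler_nat (leq_trans h4) // leq_add2r.
by rewrite ler_norml; apply/andP; split; lra.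
Qed.


Section Configurations.
Variables (V P : finType) (ver : P -> V) (tw : P -> P) (d : nat).
Hypothesis twK : involutive tw.
Hypothesis tw_neq : forall x, tw x != x.
Hypothesis card_ver : forall v, #|[set p | ver p == v]| = d.
Implicit Type s : {perm P}.

(* The pairs (x, tw x) among the clashes are the loops. *)
Definition clashes s : {set P * P} := [set p | [&& p.1 != p.2,
  ver (s p.1) == ver (s p.2) & ver (s (tw p.1)) == ver (s (tw p.2))]].

(** Without clashes a half-edge is determined by the ordered pair of its end vertices, which
    excludes loops as well as multiple edges. *)
Definition simple_conf : {set {perm P}} := [set s | clashes s == finset.set0].

Definition edge s x : {set V} := [set ver (s x); ver (s (tw x))].

Definition conf_graph s : {set {set V}} := [set edge s x | x : P].

Lemma simple_confP s : reflect
  (forall x y, ver (s x) = ver (s y) -> ver (s (tw x)) = ver (s (tw y)) -> x = y)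
  (s \in simple_conf).
Proof.
rewrite finset.inE; apply: (iffP eqP) => [s0 x y e1 e2|inj].
  apply/eqP; apply: contraT => xy.
  by have := finset.in_set0 (x, y); rewrite -s0 finset.inE /= xy e1 e2 !eqxx.
apply/setP => -[x y]; rewrite !finset.inE /=; apply/negP => /and3P[xy /eqP e1 /eqP e2].
by move: xy; rewrite (inj x y e1 e2) eqxx.
Qed.

Lemma edge_tw s x : edge s (tw x) = edge s x.
Proof. by rewrite /edge twK finset.setUC. Qed.

Lemma simple_conf_loop s x : s \in simple_conf -> ver (s x) != ver (s (tw x)).
Proof.
move=> /simple_confP inj; apply: contraNneq (tw_neq x) => e.
by rewrite -(inj x (tw x)) // twK.
Qed.

Lemma edge_eq s t x y : s \in simple_conf -> edge s x = edge t y ->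
  (ver (s x) = ver (t y) /\ ver (s (tw x)) = ver (t (tw y))) \/
  (ver (s x) = ver (t (tw y)) /\ ver (s (tw x)) = ver (t y)).
Proof.
move=> ss; have ab := simple_conf_loop x ss; move=> E.
have : ver (s x) \in edge t y by rewrite -E !finset.inE eqxx.
have : ver (s (tw x)) \in edge t y by rewrite -E !finset.inE eqxx orbT.
rewrite !finset.inE => /orP[]/eqP e1 /orP[]/eqP e2; rewrite e1 e2 in ab *.
- by rewrite eqxx in ab.
- by right.
- by left.
- by rewrite eqxx in ab.
Qed.

Lemma card_ver_perm s v : #|[set x | ver (s x) == v]| = d.
Proof.
rewrite -(card_ver v) -(card_preimset [set p | ver p == v] (@perm_inj _ s)).
by apply: eq_card => x; rewrite !inE.
Qed.

Lemma conf_graph_regular s : s \in simple_conf -> regular_graph d (conf_graph s).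
Proof.
move=> ss; apply/andP; split.
  apply/forallP => e; apply/implyP => /imsetP[x _ ->].
  by rewrite cards2 simple_conf_loop.
apply/forallP => v; rewrite -(card_ver_perm s v); apply/eqP.
rewrite /degree (_ : [set e in conf_graph s | v \in e] =
   [set edge s x | x in [set x | ver (s x) == v]]).
  apply: card_in_imset => x y; rewrite !finset.inE => /eqP xv /eqP yv.
  move=> /(edge_eq ss)[[e1 e2]|[e1 e2]]; first exact: (simple_confP _ ss).
  have := simple_conf_loop y ss; rewrite -e1 xv -yv eqxx //.
apply/setP => e; rewrite !finset.inE; apply/andP/imsetP.
  move=> [/imsetP[x _ ->]]; rewrite !finset.inE => /orP[/eqP vx|/eqP vx].
    by exists x; rewrite ?finset.inE -?vx.
  by exists (tw x); rewrite ?finset.inE -?vx // edge_tw.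
move=> [x]; rewrite finset.inE => /eqP <- ->; split; first exact: imset_f.
by rewrite !finset.inE eqxx.
Qed.

(** Each cut edge is represented by its unique half-edge on the side of [S]. *)
Lemma conf_graph_cut s (S : {set V}) : s \in simple_conf ->
  graph_cut (conf_graph s) S =
  #|[set x | (ver (s x) \in S) && (ver (s (tw x)) \notin S)]|.
Proof.
move=> ss; rewrite /graph_cut.
have card1 x : (#|edge s x :&: S| == 1)%N = ((ver (s x) \in S) (+) (ver (s (tw x)) \in S)).
  have -> : #|edge s x :&: S| = ((ver (s x) \in S) + (ver (s (tw x)) \in S))%N.
    rewrite -sum1_card big_mkcond /=.
    rewrite (bigD1 (ver (s x))) //= (bigD1 (ver (s (tw x)))) /=; last first.
      by rewrite eq_sym simple_conf_loop.
    rewrite big1 ?addn0 => [|v /andP[v1 v2]]; last first.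
      by rewrite !finset.inE (negbTE v1) (negbTE v2).
    by rewrite !finset.inE !eqxx ?orbT /=; do 2!case: (_ \in S).
  by do 2!case: (_ \in S).
rewrite (_ : [set e in conf_graph s | _] =
   [set edge s x | x in [set x | (ver (s x) \in S) && (ver (s (tw x)) \notin S)]]).
  apply: card_in_imset => x y; rewrite !finset.inE => /andP[xS txS] /andP[yS tyS].
  move=> /(edge_eq ss)[[e1 e2]|[e1 e2]]; first exact: (simple_confP _ ss).
  by move: xS; rewrite e1 (negbTE tyS).
apply/setP => e; rewrite !finset.inE; apply/andP/imsetP.
  move=> [/imsetP[x _ ->]]; rewrite card1 => h.
  have [xS|xS] := boolP (ver (s x) \in S).
    by exists x => //; rewrite finset.inE xS; move: h; rewrite xS.
  exists (tw x); last by rewrite edge_tw.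
  rewrite finset.inE twK xS andbT.
  by move: h; rewrite (negbTE xS).
move=> [x]; rewrite finset.inE => /andP[xS txS] ->; split; first exact: imset_f.
by rewrite card1 xS (negbTE txS).
Qed.

Variable base : seq P.
Let l := [seq (x, tw x) | x <- base].
Hypothesis base_perm : perm_eq (pts l) (enum P).

Definition vercol (S : {set V}) (p : P) : bool := ver p \in S.

Lemma count_sep_conf s (S : {set V}) : count (sep vercol S) (emap s l) =
  #|[set x | (ver (s x) \in S) && (ver (s (tw x)) \notin S)]|.
Proof.
pose Q x := (ver (s x) \in S) && (ver (s (tw x)) \notin S).
have -> : #|[set x | Q x]| = count Q (pts l).
  move/seq.permP: base_perm => ->; rewrite -size_filter cardE; congr size.
  by rewrite [LHS]/enum_mem /= -enumT; apply: eq_filter => x; rewrite [LHS]inE.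
rewrite /l; elim: base => //= x t IH; rewrite -[flatten _]/(pts _) IH.
rewrite /sep /vercol /Q /= twK.
by case: (ver (s x) \in S); case: (ver (s (tw x)) \in S) => /=; rewrite ?addnA.
Qed.

Lemma MaxCut_conf s : s \in simple_conf ->
  MaxCut (conf_graph s) = maxsep [set: {set V}] vercol (emap s l).
Proof.
move=> ss; apply: eq_big => [S|S _]; first by rewrite finset.inE.
by rewrite conf_graph_cut // count_sep_conf.
Qed.

Lemma MaxBis_conf s : s \in simple_conf ->
  MaxBis (conf_graph s) =
  maxsep [set S : {set V} | #|S| == (#|V|)./2] vercol (emap s l).
Proof.
move=> ss; apply: eq_big => [S|S _]; first by rewrite finset.inE.
by rewrite conf_graph_cut // count_sep_conf.
Qed.

End Configurations.

(** * Uniformity of the graph of a random simple configuration *)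

Section Fibres.
Variables (V P : finType) (ver : P -> V) (tw : P -> P) (d : nat).
Hypothesis twK : involutive tw.
Hypothesis tw_neq : forall x, tw x != x.
Hypothesis card_ver : forall v, #|[set p | ver p == v]| = d.
Implicit Type s : {perm P}.
Local Notation simple := (simple_conf ver tw).
Local Notation graph := (conf_graph ver tw).

Definition twin_perms : {set {perm P}} :=
  [set w : {perm P} | [forall x, w (tw x) == tw (w x)]].

Lemma twin_permsP (w : {perm P}) :
  reflect (forall x, w (tw x) = tw (w x)) (w \in twin_perms).
Proof.
by rewrite finset.inE; apply: (iffP forallP) => h x; apply/eqP; rewrite h.
Qed.

(** Each half-edge of [s] has the same ordered ends as exactly one half-edge of [t], as [t] is
    simple. This matching [h] commutes with [tw], and what remains permutes the points over each
    vertex. *)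
Lemma conf_factor s t : s \in simple -> t \in simple -> graph s = graph t ->
  exists w k, [/\ w \in twin_perms, k \in block_perms ver & s = (w * t * k)%g].
Proof.
move=> /(simple_confP ver tw) sinj tS; have /(simple_confP ver tw) tinj := tS => st.
pose lifts x y := (ver (t y) == ver (s x)) && (ver (t (tw y)) == ver (s (tw x))).
have ex x : exists y, lifts x y.
  have : edge ver tw s x \in graph t by rewrite -st imset_f.
  move=> /imsetP[y _ /esym /(edge_eq twK tw_neq tS)[[e1 e2]|[e1 e2]]].
    by exists y; rewrite /lifts e1 e2 !eqxx.
  by exists (tw y); rewrite /lifts twK e1 e2 !eqxx.
pose h x := xchoose (ex x).
have hP x : ver (t (h x)) = ver (s x) /\ ver (t (tw (h x))) = ver (s (tw x)).
  by have /andP[/eqP ? /eqP ?] := xchooseP (ex x).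
have hI : injective h.
  move=> x y hxy; have [e1 e2] := hP x; have [e3 e4] := hP y.
  by apply: sinj; [rewrite -e1 -e3 hxy|rewrite -e2 -e4 hxy].
have htw x : h (tw x) = tw (h x).
  have [e1 e2] := hP x; have [e3 e4] := hP (tw x); rewrite twK in e4.
  by apply: tinj; [rewrite e3 -e2|rewrite twK e4 -e1].
pose w := perm hI.
exists w, ((w * t)^-1 * s)%g; split.
- by apply/twin_permsP => x; rewrite !permE htw.
- apply/block_permsP => y; rewrite permM.
  set x := ((w * t)^-1)%g y; have -> : y = t (h x).
    by rewrite -(permE hI) -permM /x -permM mulVg perm1.
  by have [-> _] := hP x.
- by rewrite mulKVg.
Qed.

(** The fibre is one orbit of the relabellings of the pairing and of the points over each vertex;
    simplicity of [t] makes the action free, so all graphs have equally many configurations. *)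
Lemma card_fibre t : t \in simple ->
  #|[set s in simple | graph s == graph t]| =
  (#|twin_perms| * #|block_perms ver|)%N.
Proof.
move=> tS; rewrite -cardsX.
rewrite (_ : [set s in simple | _] =
  [set (p.1 * t * p.2)%g | p in finset.setX twin_perms (block_perms ver)]).
  apply: card_in_imset => -[w k] [w' k'].
  rewrite !finset.in_setX /= => /andP[/twin_permsP wT /block_permsP kB].
  move=> /andP[/twin_permsP wT' /block_permsP kB'] E.
  have Ex x : k (t (w x)) = k' (t (w' x)).
    by move/permP: E => /(_ x); rewrite !permM.
  have ww : w = w'.
    apply/permP => x; apply: (simple_confP _ _ _ tS).
      by rewrite -kB Ex kB'.
    by rewrite -wT -wT' -kB Ex kB'.
  by move: E; rewrite ww => /mulgI ->.
apply/setP => s; rewrite finset.inE; apply/andP/imsetP.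
  move=> [sS /eqP st]; have [w [k [wT kB ->]]] := conf_factor sS tS st.
  by exists (w, k); rewrite // finset.in_setX wT.
move=> [[w k]]; rewrite finset.in_setX /= => /andP[/twin_permsP wT /block_permsP kB] ->.
have ver1 x : ver ((w * t * k)%g x) = ver (t (w x)) by rewrite !permM kB.
split.
  apply/simple_confP => x y; rewrite !ver1 !wT => e1 e2.
  by apply: (@perm_inj _ w); exact: (simple_confP _ _ _ tS).
have ed x : edge ver tw (w * t * k)%g x = edge ver tw t (w x).
  by rewrite /edge !ver1 wT.
apply/eqP/setP => e; apply/imsetP/imsetP => -[x _ ->].
  by exists (w x).
by exists (w^-1%g x) => //; rewrite ed permKV.
Qed.

Variable base : seq P.
Let l := [seq (x, tw x) | x <- base].
Hypothesis base_perm : perm_eq (pts l) (enum P).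
Variable p0 : P.

Lemma uniq_dart_pts (E : eqType) (a b : E -> V) (es : seq E) : uniq es ->
  (forall e, e \in es -> a e != b e) ->
  uniq (pts [seq ((a e, e), (b e, e)) | e <- es]).
Proof.
elim: es => //= e es IH /andP[ees ues] ab; rewrite -[flatten _]/(pts _).
have notin v : (v, e) \notin pts [seq ((a e, e), (b e, e)) | e <- es].
  apply: contra ees; rewrite /pts => /flattenP[_ /mapP[_ /mapP[e' e'es ->] ->]] /=.
  by rewrite !inE !xpair_eqE => /orP[]/andP[_ /eqP ->].
rewrite IH ?andbT //; last by move=> e' e'es; apply: ab; rewrite inE e'es orbT.
rewrite inE negb_or !notin xpair_eqE eqxx !andbT.
by apply: ab; rewrite mem_head.
Qed.

(** The [d] edges at a vertex are numbered by the [d] points over it, which gives each dart (vertex,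
    edge) its own point; a permutation then carries the pairing to the list of edges. *)
Lemma regular_conf (E : {set {set V}}) : regular_graph d E ->
  exists2 s, s \in simple & graph s = E.
Proof.
move=> /andP[/forallP E2 /forallP Ed].
have endsP e : e \in E -> exists p : V * V, (p.1 != p.2) && (e == [set p.1; p.2]).
  move=> eE; have := E2 e; rewrite eE => /cards2P[a [b [ab eab]]].
  by exists (a, b); rewrite ab eab eqxx.
pose ends e : V * V := odflt (ver p0, ver p0) [pick p | (p.1 != p.2) && (e == [set p.1; p.2])].
have endsE e : e \in E -> (ends e).1 != (ends e).2 /\ e = [set (ends e).1; (ends e).2].
  move=> /endsP[p hp]; rewrite /ends; case: pickP => [q /= /andP[qq /eqP qe]|/(_ p)].
    by split.
  by rewrite /= hp.
pose inc v := enum [set e in E | v \in e].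
pose fib v := enum [set p | ver p == v].
have sz_inc v : size (inc v) = d by rewrite -cardE; apply/eqP; exact: Ed.
have sz_fib v : size (fib v) = d by rewrite -cardE card_ver.
pose pt (z : V * {set V}) := nth p0 (fib z.1) (index z.2 (inc z.1)).
pose dart (z : V * {set V}) := (z.2 \in E) && (z.1 \in z.2).
have idx z : dart z -> (index z.2 (inc z.1) < d)%N.
  by move=> /andP[h1 h2]; rewrite -(sz_inc z.1) index_mem mem_enum finset.inE h1.
have ver_pt z : dart z -> ver (pt z) = z.1.
  move=> zD; have : pt z \in fib z.1 by rewrite mem_nth // sz_fib idx.
  by rewrite mem_enum finset.inE => /eqP.
have pt_inj z z' : dart z -> dart z' -> pt z = pt z' -> z = z'.
  move=> zD zD' zz; have v := ver_pt _ zD; rewrite zz (ver_pt _ zD') in v.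
  case: z z' v zD zD' zz => [v e] [v' e'] /= <- zD zD'.
  rewrite /pt /= => /eqP; rewrite nth_uniq ?sz_fib ?enum_uniq ?(idx _ zD) ?(idx _ zD') //.
  move=> /eqP ii; congr (_, _).
  rewrite -(nth_index e (s := inc v') (x := e)); last first.
    by rewrite mem_enum finset.inE; exact: zD.
  by rewrite ii nth_index // mem_enum finset.inE; exact: zD'.
pose darts := [seq (((ends e).1, e), ((ends e).2, e)) | e <- enum E].
have dartsP z : z \in pts darts = dart z.
  rewrite /pts; apply/flattenP/idP.
    move=> [_ /mapP[_ /mapP[e eE ->] ->]] /=; rewrite mem_enum in eE.
    have [ab eE'] := endsE e eE.
    by rewrite !inE => /orP[]/eqP ->; rewrite /dart /= eE {2}eE' !finset.inE eqxx ?orbT.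
  move: z => [v e] /andP[/= eE ve]; have [ab eE'] := endsE e eE.
  exists [:: ((ends e).1, e); ((ends e).2, e)].
    by apply/mapP; exists (((ends e).1, e), ((ends e).2, e)) => //; apply/mapP; exists e; rewrite ?mem_enum.
  by move: ve; rewrite {1}eE' finset.in_set2 !inE !xpair_eqE eqxx !andbT.
have uD : uniq (pts darts).
  by apply: uniq_dart_pts; [exact: enum_uniq|move=> e; rewrite mem_enum => /endsE[]].
have uptD : uniq (pts (emap pt darts)).
  by rewrite pts_emap map_inj_in_uniq // => z z'; rewrite !dartsP; exact: pt_inj.
have ul : uniq (pts l) by rewrite (perm_uniq base_perm) enum_uniq.
have ptD_perm : perm_eq (pts (emap pt darts)) (enum P).
  apply: uniq_perm; rewrite ?enum_uniq // => p; rewrite mem_enum pts_emap; apply/mapP.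
  have pF : p \in fib (ver p) by rewrite mem_enum finset.inE.
  have iF : (index p (fib (ver p)) < size (inc (ver p)))%N.
    by rewrite sz_inc -(sz_fib (ver p)) index_mem.
  pose e := nth finset.set0 (inc (ver p)) (index p (fib (ver p))).
  have eI : e \in inc (ver p) by exact: mem_nth.
  exists (ver p, e); first by rewrite dartsP /dart; move: eI; rewrite mem_enum finset.inE.
  by rewrite /pt /= /e index_uniq ?enum_uniq // nth_index.
(* With a constant colouring only the lengths of the two lists have to agree. *)
have [|s [_ sl]] := perm_extension (b := fun=> tt) ul uptD.
  have szE : size (pts l) = size (pts (emap pt darts)).
    by rewrite (perm_size base_perm) (perm_size ptD_perm).
  by elim: (pts l) (pts (emap pt darts)) szE => [|x t IH] [|y t'] //= [/IH ->].
have sE : emap s l = emap pt darts by apply: pts_inj; rewrite -sl pts_emap.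
have lP x : (x, tw x) \in l \/ (tw x, tw (tw x)) \in l.
  have : x \in pts l by rewrite (perm_mem base_perm) mem_enum.
  rewrite /pts => /flattenP[_ /mapP[_ /mapP[y yb ->] ->]] /=.
  rewrite !inE => /orP[]/eqP ->; [left|right; rewrite !twK]; exact: map_f.
have H x : (edge ver tw s x \in E) /\ s x = pt (ver (s x), edge ver tw s x).
  have key y : (y, tw y) \in l -> exists2 e, e \in E &
      s y = pt ((ends e).1, e) /\ s (tw y) = pt ((ends e).2, e).
    move=> yl; have : (s y, s (tw y)) \in emap s l by exact: (map_f (fun e => (s e.1, s e.2)) yl).
    rewrite sE => /mapP[_ /mapP[e eE ->] /= [-> ->]]; exists e => //.
    by rewrite -mem_enum.
  have dart1 e : e \in E -> dart ((ends e).1, e).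
    by move=> eE; have [_ eE'] := endsE e eE; rewrite /dart /= eE {2}eE' !finset.inE eqxx.
  have dart2 e : e \in E -> dart ((ends e).2, e).
    by move=> eE; have [_ eE'] := endsE e eE; rewrite /dart /= eE {2}eE' !finset.inE eqxx orbT.
  have edE y e : e \in E -> s y = pt ((ends e).1, e) -> s (tw y) = pt ((ends e).2, e) ->
      edge ver tw s y = e.
    move=> eE e1 e2; rewrite /edge e1 e2 !ver_pt ?dart1 ?dart2 //=.
    by have [_ <-] := endsE e eE.
  case: (lP x) => /key[e eE [e1 e2]].
    by rewrite (edE x e) // {1}e1; split=> //; rewrite e1 ver_pt ?dart1.
  rewrite -(edge_tw ver twK) (edE (tw x) e) //; rewrite twK in e2.
  by split=> //; rewrite e2 ver_pt ?dart2.
exists s.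
  apply/simple_confP => x y e1 e2; apply: (@perm_inj _ s).
  have [_ ->] := H x; have [_ ->] := H y.
  by rewrite /edge e1 e2.
apply/setP => e; apply/imsetP/idP => [[x _ ->]|eE]; first by have [] := H x.
have : (pt ((ends e).1, e), pt ((ends e).2, e)) \in emap s l.
  rewrite sE; apply/mapP; exists (((ends e).1, e), ((ends e).2, e)) => //.
  by apply/mapP; exists e; rewrite ?mem_enum.
move=> /mapP[_ /mapP[x xb ->] /= [e1 e2]]; exists x => //.
have [_ eE'] := endsE e eE.
by rewrite /edge -e1 -e2 !ver_pt //= /dart /= eE {2}eE' !finset.inE eqxx ?orbT.
Qed.

Lemma mean_simple_conf (R : realType) (f : {set {set V}} -> R) :
  uniform_mean simple (fun s => f (graph s)) =
  uniform_mean [set E : {set {set V}} | regular_graph d E] f.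
Proof.
have S (V' : nmodType) (g : {set {set V}} -> V') :
    \sum_(s in simple) g (graph s) =
    \sum_(E in [set E : {set {set V}} | regular_graph d E]) g E *+ (#|twin_perms| * #|block_perms ver|).
  rewrite (partition_big graph [in [set E : {set {set V}} | regular_graph d E]]) /=; last first.
    by move=> s sS; rewrite finset.inE; exact: (conf_graph_regular twK tw_neq).
  apply: eq_bigr => E; rewrite finset.inE => /regular_conf[t tS tE].
  rewrite -(card_fibre tS) tE -sumr_const; apply: eq_big => s.
    by rewrite finset.inE.
  by move=> /andP[_ /eqP ->].
have c0 : (#|twin_perms| * #|block_perms ver|)%:R != 0 :> R.
  rewrite pnatr_eq0 muln_eq0 negb_or -!lt0n !card_gt0 block_perms_neq0 andbT.
  by apply/set0Pn; exists 1%g; apply/twin_permsP => x; rewrite !perm1.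
rewrite /uniform_mean -[#|simple|]sum1_card natr_sum.
rewrite (S _ (fun=> 1)) S !sumrMnl sumr_const.
set c := (_ * _)%N; set u := \sum_(_ in _) _; set v := 1 *+ _.
rewrite -(mulr_natr u) -(mulr_natr v) invfM mulrACA divff ?mulr1 //.
Qed.

End Fibres.

(** * Switchings *)

Section SimpleProbability.
Variables (V P : finType) (ver : P -> V) (tw : P -> P) (d : nat).
Hypothesis twK : involutive tw.
Hypothesis tw_neq : forall x, tw x != x.
Hypothesis card_ver : forall v, #|[set p | ver p == v]| = d.
Implicit Type s : {perm P}.
Local Notation clash := (clashes ver tw).

Section Switching.
Variables (s : {perm P}) (x y z : P).
Hypothesis xy : (x, y) \in clash s.
Hypothesis z_far1 : (ver (s z) != ver (s x)) && (ver (s z) != ver (s (tw x))).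
Hypothesis z_far2 : (ver (s (tw z)) != ver (s x)) && (ver (s (tw z)) != ver (s (tw x))).
Hypothesis z_loop : ver (s z) != ver (s (tw z)).
Hypothesis z_adj1 : forall u, ver (s u) = ver (s x) -> ver (s (tw u)) != ver (s z).
Hypothesis z_adj2 : forall u, ver (s u) = ver (s (tw x)) -> ver (s (tw u)) != ver (s (tw z)).

(** The edges at [x] and [z] are crossed: the new ones join the ends of [x] and [z], and those of
    [tw x] and [tw z]. The hypotheses on [z] make them neither loops nor parallel to another edge,
    so no clash involves the four half-edges any more, and all other pairs are as before. *)
Lemma switch_clashes : clash (s * tperm (s (tw x)) (s z))%g \proper clash s.
Proof.
set t := (s * _)%g.
have [n1 n2] := andP z_far1; have [n3 n4] := andP z_far2.
have tx : t x = s x.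
  rewrite permM tpermD //; last by apply: contraNneq n1 => ->.
  by rewrite (inj_eq perm_inj).
have ttx : t (tw x) = s z by rewrite permM tpermL.
have tz : t z = s (tw x) by rewrite permM tpermR.
have ttz : t (tw z) = s (tw z).
  rewrite permM tpermD //; first by apply: contraNneq n4 => ->.
  by rewrite (inj_eq perm_inj) eq_sym.
have tu u : u != tw x -> u != z -> t u = s u.
  by move=> ux uz; rewrite permM tpermD // (inj_eq perm_inj) eq_sym.
have clashP (r : {perm P}) p q : (p, q) \in clash r = [&& p != q, ver (r p) == ver (r q)
    & ver (r (tw p)) == ver (r (tw q))] by rewrite finset.inE.
have tw_eq u v : (tw u == tw v) = (u == v) by rewrite (inj_eq (inv_inj twK)).
have twz u v : (tw u == v) = (u == tw v) by rewrite -{1}(twK v) tw_eq.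
have noX q : (x, q) \notin clash t.
  rewrite clashP tx ttx; apply/negP => /and3P[xq /eqP e1 /eqP e2].
  have [q1|q1] := eqVneq q (tw x); first by move: n1; rewrite e1 q1 ttx eqxx.
  have [q2|q2] := eqVneq q z; first by move: z_loop; rewrite e2 q2 ttz eqxx.
  have [q3|q3] := eqVneq q (tw z); first by move: n3; rewrite e1 q3 ttz eqxx.
  rewrite tu // in e1; rewrite tu ?tw_eq 1?eq_sym // 1?eq_sym ?twz // in e2.
  by have := z_adj1 (esym e1); rewrite e2 eqxx.
have noZ q : (z, q) \notin clash t.
  rewrite clashP tz ttz; apply/negP => /and3P[zq /eqP e1 /eqP e2].
  have [q1|q1] := eqVneq q x; first by move: z_loop; rewrite e2 q1 ttx eqxx.
  have [q2|q2] := eqVneq q (tw x); first by move: n2; rewrite e1 q2 ttx eqxx.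
  have [q3|q3] := eqVneq q (tw z); first by move: n4; rewrite e1 q3 ttz eqxx.
  rewrite tu // 1?eq_sym // in e1; rewrite tu ?tw_eq ?twz // in e2.
  by have := z_adj2 (esym e1); rewrite e2 eqxx.
have symm (r : {perm P}) p q : ((p, q) \in clash r) = ((q, p) \in clash r).
  by rewrite !clashP eq_sym [ver (r p) == _]eq_sym [ver (r (tw p)) == _]eq_sym.
have twm (r : {perm P}) p q : ((tw p, tw q) \in clash r) = ((p, q) \in clash r).
  by rewrite !clashP !twK tw_eq; congr (_ && _); rewrite andbC.
have noT p q : [|| p == x, p == tw x, p == z | p == tw z] -> (p, q) \notin clash t.
  move=> /or4P[]/eqP ->; [exact: noX| |exact: noZ|].
    by rewrite -twm twK; exact: noX.
  by rewrite -twm twK; exact: noZ.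
apply/properP; split; last by exists (x, y).
apply/fintype.subsetP => -[p q] pq.
have : ~~ [|| p == x, p == tw x, p == z | p == tw z] by apply: contraL pq => /noT.
have : ~~ [|| q == x, q == tw x, q == z | q == tw z].
  by apply: contraL pq => /noT; rewrite symm.
rewrite !negb_or => /and4P[p1 p2 p3 p4] /and4P[q1 q2 q3 q4].
by move: pq; rewrite !clashP !tu ?tw_eq ?twz.
Qed.

End Switching.

Lemma card_ver_le (r : {perm P}) v : (#|[set z | ver (r z) == v]| <= d)%N.
Proof. by rewrite (card_ver_perm card_ver). Qed.

Lemma card_adj (r : {perm P}) (g : P -> P) v : injective g ->
  (#|[set z | [exists u, (ver (r u) == v) && (ver (r (tw u)) == ver (r (g z)))]]| <= d * d)%N.
Proof.
move=> gI.
apply: leq_trans (_ : #|\bigcup_(u in [set u | ver (r u) == v])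
   [set z | ver (r (g z)) == ver (r (tw u))]| <= _)%N.
  apply: subset_leq_card; apply/fintype.subsetP => z; rewrite finset.inE.
  move=> /existsP[u /andP[u1 u2]]; apply/finset.bigcupP; exists u.
    by rewrite finset.inE.
  by rewrite finset.inE eq_sym.
apply: leq_trans (_ : \sum_(u in [set u | ver (r u) == v]) d <= _)%N; last first.
  by rewrite sum_nat_const leq_mul2r card_ver_le orbT.
elim/big_ind2: _ => [|A m B n Am Bn|u _]; first by rewrite cards0.
  by apply: leq_trans (leq_add Am Bn); rewrite cardsU leq_subr.
rewrite -(card_ver_perm card_ver r (ver (r (tw u)))).
rewrite -(card_imset _ gI); apply: subset_leq_card.
by apply/fintype.subsetP => _ /imsetP[w + ->]; rewrite !finset.inE.
Qed.

(** The bound counts the forbidden [z]: [4 d] near the ends, [2 d^2] by adjacency, and at most [J]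
    on loops, since [(z, tw z)] is then itself a clash. *)
Lemma exists_switch (s : {perm P}) J : (#|clash s| <= J)%N ->
  (4 * d + 2 * (d * d) + J < #|P|)%N -> clash s != finset.set0 ->
  exists b c, clash (s * tperm b c)%g \proper clash s.
Proof.
move=> sJ big /set0Pn[[x y] xy].
pose B1 := [set z | ver (s z) == ver (s x)].
pose B2 := [set z | ver (s z) == ver (s (tw x))].
pose B3 := [set z | ver (s (tw z)) == ver (s x)].
pose B4 := [set z | ver (s (tw z)) == ver (s (tw x))].
pose B5 := [set z | ver (s z) == ver (s (tw z))].
pose B6 := [set z | [exists u, (ver (s u) == ver (s x)) && (ver (s (tw u)) == ver (s z))]].
pose B7 := [set z | [exists u, (ver (s u) == ver (s (tw x))) && (ver (s (tw u)) == ver (s (tw z)))]].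
have twI : injective tw by exact: inv_inj twK.
have c12 v : (#|[set z | ver (s z) == v]| <= d)%N by exact: card_ver_le.
have c34 v : (#|[set z | ver (s (tw z)) == v]| <= d)%N.
  apply: leq_trans (c12 v); rewrite -(card_imset _ twI).
  by apply: subset_leq_card; apply/fintype.subsetP => _ /imsetP[w + ->]; rewrite !finset.inE.
have c5 : (#|B5| <= J)%N.
  apply: leq_trans sJ; rewrite -(card_imset (f := fun z => (z, tw z)) B5); last by move=> u v [].
  apply: subset_leq_card; apply/fintype.subsetP => _ /imsetP[w + ->].
  rewrite !finset.inE /= => /eqP e; rewrite twK e eqxx !andbT.
  by rewrite eq_sym tw_neq.
have c6 : (#|B6| <= d * d)%N by exact: (card_adj s (g := id)).
have c7 : (#|B7| <= d * d)%N by exact: (card_adj s (g := tw)).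
have U (A B : {set P}) m n : (#|A| <= m -> #|B| <= n -> #|A :|: B| <= m + n)%N.
  by move=> Am Bn; apply: leq_trans (leq_add Am Bn); rewrite cardsU leq_subr.
pose B := B1 :|: B2 :|: B3 :|: B4 :|: B6 :|: B7 :|: B5.
have cB : (#|B| < #|P|)%N.
  apply: leq_ltn_trans big.
  have := U _ _ _ _ (U _ _ _ _ (U _ _ _ _ (U _ _ _ _ (U _ _ _ _ (U _ _ _ _ (c12 (ver (s x))) (c12 (ver (s (tw x))))) (c34 (ver (s x)))) (c34 (ver (s (tw x))))) c6) c7) c5.
  move=> /leq_trans; apply; lia.
have [z zB] : exists z, z \notin B.
  apply/existsP; apply: contraTT cB; rewrite negb_exists => /forallP Ball.
  rewrite -leqNgt -cardsT; apply: subset_leq_card; apply/fintype.subsetP => z _.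
  by have := Ball z; rewrite negbK.
move: zB; rewrite !finset.inE !negb_or.
move=> /andP[/andP[/andP[/andP[/andP[/andP[z1 z2] z3] z4] z6] z7] z5].
exists (s (tw x)), (s z); apply: (@switch_clashes s x y z); rewrite ?z1 ?z2 ?z3 ?z4 //.
  by move=> u e; apply: contra z6 => e'; apply/existsP; exists u; rewrite e eqxx.
by move=> u e; apply: contra z7 => e'; apply/existsP; exists u; rewrite e eqxx.
Qed.

Definition few_clashes J : {set {perm P}} := [set s : {perm P} | (#|clash s| <= J)%N].

(** A switching is undone by its own transposition, so each permutation with at most [J + 1] clashes
    is one with at most [J] clashes times some [tperm b c], for which there are [#|P|^2] choices of
    [(b, c)]. *)
Lemma card_few_clashes J : (4 * d + 2 * (d * d) + J < #|P|)%N ->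
  (#|few_clashes J| <= (#|P| * #|P|) ^ J * #|simple_conf ver tw|)%N.
Proof.
elim: J => [|J IH] big.
  rewrite expn0 mul1n; apply: subset_leq_card; apply/fintype.subsetP => s.
  by rewrite !finset.inE leqn0 cards_eq0.
have {}IH := IH (leq_trans (_ : _ < _)%N big).
apply: leq_trans (_ : #|few_clashes J| * (#|P| * #|P|) <= _)%N; last first.
  by rewrite expnSr mulnAC leq_mul2r IH ?orbT// addnS.
have -> : (#|few_clashes J| * (#|P| * #|P|) =
    #|finset.setX (few_clashes J) [set: P * P]|)%N by rewrite cardsX cardsT card_prod.
pose h (p : {perm P} * (P * P)) := (p.1 * tperm p.2.1 p.2.2)%g.
apply: leq_trans (leq_imset_card h _); apply: subset_leq_card.
apply/fintype.subsetP => s; rewrite finset.inE => sJ; apply/imsetP.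
have [s0|s0] := eqVneq (clash s) finset.set0.
  have /card_gt0P[x _] : (0 < #|P|)%N by apply: leq_ltn_trans big.
  exists (s, (x, x)); last by rewrite /h /= tperm1 mulg1.
  by rewrite !finset.inE s0 cards0.
have [b [c bc]] := exists_switch sJ big s0.
exists ((s * tperm b c)%g, (b, c)); last by rewrite /h /= -mulgA tperm2 mulg1.
rewrite !finset.inE andbT -ltnS; exact: leq_trans (proper_card bc) sJ.
Qed.

(** * First moment of the number of clashes *)

Section FirstMoment.
Variable R : realType.
Local Notation E f := (uniform_mean [set: {perm P}] f : R).

Lemma mean_perm_translate (t : {perm P}) (f : {perm P} -> R) :
  E (fun s => f (t * s)%g) = E f.
Proof.
by apply: (mean_reindex _ (h := fun s => (t * s)%g)) => [|s]; [exact: mulgI|rewrite !finset.inE].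
Qed.

Lemma permsT_neq0 : [set: {perm P}] != finset.set0.
Proof. by apply/set0Pn; exists 1%g; rewrite finset.inE. Qed.

Lemma sum_ver_le s v : \sum_z (v == ver (s z))%:R <= d%:R :> R.
Proof.
rewrite -natr_sum ler_nat; apply: leq_trans (card_ver_le s v).
rewrite -sum1_card big_mkcond [leqRHS]big_mkcond; apply: leq_sum => z _ /=.
by rewrite finset.inE eq_sym; case: eqP.
Qed.

(** Translation lets any point [z] other than [x] stand in for [tw x], so one may average over [z];
    for fixed [s] at most [d] points share the vertex of [s x]. *)
Lemma mean_clash_twin x : (2 <= #|P|)%N ->
  E (fun s => ((x, tw x) \in clash s)%:R) <= d%:R / (#|P| - 1)%N%:R.
Proof.
move=> P2; have P0 : (0 : R) < (#|P| - 1)%N%:R by rewrite ltr0n subn_gt0.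
rewrite ler_pdivlMr// mulrC.
have card1 : #|[set~ x]| = (#|P| - 1)%N by rewrite cardsC1 subn1.
rewrite -card1 mulr_natl -sumr_const.
apply: le_trans (_ : \sum_(z in [set~ x]) E (fun s => (ver (s x) == ver (s z))%:R) <= _).
  apply: ler_sum => z; rewrite !finset.inE => zx.
  rewrite -(mean_perm_translate (tperm (tw x) z)); apply: ler_mean => s _.
  have tE : tperm (tw x) z x = x by rewrite tpermD.
  rewrite finset.inE /= !permM tpermL tE.
  by rewrite ler_nat; case: (ver (s x) == _); rewrite /= ?andbF ?leq_b1.
rewrite -mean_sum -[leRHS](mean_cst _ permsT_neq0); apply: ler_mean => s _.
apply: le_trans (sum_ver_le s (ver (s x))).
by rewrite big_mkcond /=; apply: ler_sum => z _; case: ifP => // _; rewrite ler0n.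
Qed.

(** The same averaging with substitutes [z] for [y] and [w] for [tw y]; the three values excluded
    for each keep the translations from disturbing [x], [tw x] and one another. *)
Lemma mean_clash_other x y : (4 <= #|P|)%N -> y != x -> y != tw x ->
  E (fun s => ((x, y) \in clash s)%:R) <= d%:R ^+ 2 / (#|P| - 3)%N%:R ^+ 2.
Proof.
move=> P4 yx ytx; have P0 : (0 : R) < (#|P| - 3)%N%:R by rewrite ltr0n subn_gt0.
have tw_eq u v : (tw u == tw v) = (u == v) by rewrite (inj_eq (inv_inj twK)).
have twz u v : (tw u == v) = (u == tw v) by rewrite -{1}(twK v) tw_eq.
have card3 (u v w : P) : u != v -> u != w -> v != w ->
    #|~: [set u; v; w]| = (#|P| - 3)%N.
  move=> uv uw vw; rewrite -(cardsC [set u; v; w]).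
  suff -> : #|[set u; v; w]| = 3 by rewrite addKn.
  rewrite cardsU cards2 uv cards1 (_ : _ :&: _ = finset.set0) ?cards0 //.
  apply/setP => p; rewrite !finset.inE andbC; have [->|//] := eqVneq p w.
  by rewrite /= eq_sym (negbTE uw) eq_sym (negbTE vw).
rewrite ler_pdivlMr ?exprn_gt0// mulrC expr2 -mulrA.
set m := E _.
have -> : (#|P| - 3)%N%:R * ((#|P| - 3)%N%:R * m) =
    \sum_(z in ~: [set x; tw x; tw y]) \sum_(w in ~: [set x; tw x; z]) m.
  rewrite (eq_bigr (fun=> (#|P| - 3)%N%:R * m)) => [|z].
    by rewrite sumr_const card3 ?mulr_natl// ?tw_eq 1?eq_sym // ?twz // eq_sym.
  rewrite !finset.inE !negb_or => /andP[/andP[zx ztx] zty].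
  by rewrite sumr_const card3 ?mulr_natl// eq_sym.
apply: le_trans (_ : E (fun s => \sum_z \sum_w (ver (s x) == ver (s z))%:R *
    (ver (s (tw x)) == ver (s w))%:R) <= _); last first.
  rewrite -[leRHS](mean_cst _ permsT_neq0); apply: ler_mean => s _.
  under eq_bigr do rewrite -mulr_sumr.
  by rewrite -mulr_suml expr2 ler_pM ?sum_ver_le ?sumr_ge0.
rewrite mean_sum big_mkcond /=; apply: ler_sum => z _.
rewrite mean_sum; case: ifP => [|_]; last first.
  by apply: sumr_ge0 => w _; rewrite -(mean_cst 0 permsT_neq0); apply: ler_mean => s _; rewrite mulr_ge0.
rewrite !finset.inE !negb_or => /andP[/andP[zx ztx] zty].
rewrite big_mkcond /=; apply: ler_sum => w _; case: ifP => [|_]; last first.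
  by rewrite -(mean_cst 0 permsT_neq0); apply: ler_mean => s _; rewrite mulr_ge0.
rewrite !finset.inE !negb_or => /andP[/andP[wx wtx] wz].
rewrite /m -(mean_perm_translate (tperm y z * tperm (tw y) w)%g); apply: ler_mean => s _.
rewrite finset.inE /= !permM tpermL.
have -> : tperm y z x = x by rewrite tpermD.
have -> : tperm (tw y) w x = x by rewrite tpermD // twz.
have -> : tperm (tw y) w z = z by rewrite tpermD // eq_sym.
have -> : tperm y z (tw x) = tw x by rewrite tpermD.
have -> : tperm (tw y) w (tw x) = tw x by rewrite tpermD // tw_eq.
have -> : tperm y z (tw y) = tw y by rewrite tpermD // 1?eq_sym // tw_neq.
rewrite tpermL -natrM ler_nat.
by case: (ver (s x) == _); case: (ver _ == _); rewrite /= ?andbF ?leq_b1.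
Qed.

Lemma mean_card_clashes : (6 <= #|P|)%N ->
  E (fun s => #|clash s|%:R) <= (2 * d + 4 * (d * d))%N%:R.
Proof.
move=> P6.
have P1 : (0 : R) < (#|P| - 1)%N%:R by rewrite ltr0n; lia.
have P3 : (0 : R) < (#|P| - 3)%N%:R by rewrite ltr0n; lia.
have -> : E (fun s => #|clash s|%:R) = \sum_p E (fun s => (p \in clash s)%:R).
  rewrite -mean_sum; apply: eq_mean => s _.
  by rewrite -sum1_card natr_sum big_mkcond; apply: eq_bigr => p _; case: (p \in _).
apply: le_trans (_ : \sum_(p : P * P) ((p.2 == tw p.1)%:R * (d%:R / (#|P| - 1)%N%:R) +
   d%:R ^+ 2 / (#|P| - 3)%N%:R ^+ 2) <= _).
  apply: ler_sum => -[x y] _ /=.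
  have h1 : 0 <= d%:R / (#|P| - 1)%N%:R :> R by rewrite divr_ge0.
  have h2 : 0 <= d%:R ^+ 2 / (#|P| - 3)%N%:R ^+ 2 :> R by rewrite divr_ge0 ?exprn_ge0.
  have [->|yt] := eqVneq y (tw x).
    by rewrite mul1r; apply: le_trans (mean_clash_twin x _) _; [lia|rewrite lerDl].
  rewrite mul0r add0r; have [->|yx] := eqVneq y x; last by apply: mean_clash_other => //; lia.
  apply: le_trans h2; rewrite -(mean_cst 0 permsT_neq0); apply: ler_mean => s _.
  by rewrite finset.inE /= eqxx.
rewrite big_split /= sumr_const card_prod -mulr_suml.
have -> : \sum_(p : P * P) (p.2 == tw p.1)%:R = #|P|%:R :> R.
  rewrite -(pair_bigA _ (fun x y => (y == tw x)%:R)) /= -sum1_card natr_sum.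
  apply: eq_bigr => x _; rewrite (bigD1 (tw x)) //= eqxx big1 ?addr0// => y.
  by move=> /negbTE ->.
have ratio k : (0 : R) < (#|P| - k)%N%:R -> (#|P| <= 2 * (#|P| - k))%N ->
    #|P|%:R / (#|P| - k)%N%:R <= 2 :> R.
  by move=> k0 Pk; rewrite ler_pdivrMr// -natrM ler_nat.
rewrite natrD !natrM; apply: lerD.
  rewrite mulrCA [leRHS]mulrC ler_wpM2l//; apply: ratio => //; lia.
rewrite -[leLHS]mulr_natr natrM -mulrA mulrC -mulrA.
rewrite (_ : _ * _ = (#|P|%:R / (#|P| - 3)%N%:R) ^+ 2 * d%:R ^+ 2); last first.
  by rewrite expr_div_n !expr2; field; rewrite gt_eqF.
rewrite -expr2 ler_wpM2r ?exprn_ge0// (_ : 4 = 2 ^+ 2); last by rewrite expr2 -natrM.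
rewrite lerXn2r ?nnegrE ?divr_ge0//; apply: ratio => //; lia.
Qed.

End FirstMoment.
End SimpleProbability.

(** With [N <= expR (t N) / t] and the chosen [t], the power [2J] takes at most half of the exponent
    [h N]; the other half absorbs the constant [K]. *)
Lemma poly_le_expR (R : realType) (J : nat) (h : R) : 0 < h ->
  exists N0 : nat, forall N : nat, (N0 <= N)%N ->
  (2 * (N * N) ^ J)%N%:R <= expR (h * N%:R).
Proof.
move=> h0; pose t := h / (4 * J.+1%:R).
have J0 : (0 : R) < J.+1%:R by rewrite ltr0n.
have t0 : 0 < t by rewrite divr_gt0 // mulr_gt0.
pose K := 2 * t^-1 ^+ (J + J).
exists (Num.truncn (2 * K / h)).+1 => N NK.
have KN : K <= 1 + h * N%:R / 2.
  have : 2 * K / h <= N%:R.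
    by apply: le_trans (ltW (truncnS_gt _)) _; rewrite ler_nat.
  rewrite ler_pdivrMr // mulrC; lra.
have Nt : N%:R <= t^-1 * expR (t * N%:R).
  rewrite ler_pdivlMl//; apply: le_trans (expR_ge1Dx _).
  by rewrite lerDr.
have E : (2 * (N * N) ^ J)%N%:R = 2 * N%:R ^+ (J + J) :> R.
  by rewrite natrM natrX natrM -expr2 -exprM mul2n addnn.
rewrite E; apply: le_trans (_ : 2 * (t^-1 * expR (t * N%:R)) ^+ (J + J) <= _).
  by rewrite ler_pM2l// lerXn2r ?nnegrE// mulr_ge0 ?invr_ge0 ?expR_ge0 ?(ltW t0).
rewrite exprMn mulrA -/K -expRM_natl.
apply: le_trans (_ : expR (h * N%:R / 2) * expR (h * N%:R / 2) <= _); last first.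
  by rewrite -expRD -splitr.
apply: ler_pM; rewrite ?expR_ge0//.
- by rewrite mulr_ge0 ?exprn_ge0 ?invr_ge0 ?(ltW t0).
- exact: le_trans KN (expR_ge1Dx _).
have tE : 4 * J.+1%:R * t = h by rewrite /t mulrC divfK // mulf_neq0 // gt_eqF.
rewrite ler_expR; apply: le_trans (_ : 2 * J.+1%:R * (t * N%:R) <= _).
  have tN : 0 <= t * N%:R by rewrite mulr_ge0 // ltW.
  apply: (ler_wpM2r tN); rewrite -natrM ler_nat addnn -mul2n.
  by rewrite leq_mul2l leqnSn orbT.
by rewrite -tE; lra.
Qed.

Section SimpleTransfer.
Variable R : realType.

(** By Markov's inequality at least half of all permutations have at most [2 K] clashes, where [K]
    bounds the mean; switchings then lead from these to simple ones. *)
Lemma card_simple_conf (V P : finType) (ver : P -> V) (tw : P -> P) (d : nat) :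
  involutive tw -> (forall x, tw x != x) ->
  (forall v, #|[set p | ver p == v]| = d) ->
  (6 + 4 * d + 2 * (d * d) + 2 * (2 * d + 4 * (d * d)) <= #|P|)%N ->
  ((#|P|)`! <= 2 * (#|P| * #|P|) ^ (2 * (2 * d + 4 * (d * d))) * #|simple_conf ver tw|)%N.
Proof.
move=> twK tw_neq card_ver big.
set K := (2 * d + 4 * (d * d))%N in big *.
have := mean_card_clashes twK tw_neq card_ver R (leq_trans _ big).
move=> /(_ ltac:(by rewrite -!addnA leq_addr)); rewrite -/K => mom.
have fc : (#|few_clashes ver tw (2 * K)| <= (#|P| * #|P|) ^ (2 * K) * #|simple_conf ver tw|)%N.
  apply: (card_few_clashes twK tw_neq card_ver); apply: leq_trans big.
  by rewrite -!addnA -[ltnLHS]add0n ltn_add2r.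
rewrite -mulnA; apply: leq_trans (_ : 2 * #|few_clashes ver tw (2 * K)| <= _)%N; last first.
  by rewrite leq_mul2l fc orbT.
have cT : #|[set: {perm P}]| = (#|P|)`!.
  rewrite -[#|P|]cardsT -card_perm; apply: eq_card => s; rewrite finset.inE.
  by apply/esym/fintype.subsetP => z; rewrite finset.inE.
set G := few_clashes _ _ _.
rewrite /uniform_mean cT ler_pdivrMr ?ltr0n ?fact_gt0// in mom.
have low : (2 * K).+1%:R * ((#|P|)`!%:R - #|G|%:R) <= K%:R * (#|P|)`!%:R :> R.
  apply: le_trans mom.
  have -> : (#|P|)`!%:R = #|G|%:R + #|~: G|%:R :> R by rewrite -cT -natrD cardsC cardsT.
  rewrite [_ + _ - _]addrC addKr mulr_natr -sumr_const.
  apply: le_trans (_ : \sum_(s in ~: G) #|clashes ver tw s|%:R <= _).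
    by apply: ler_sum => s; rewrite !finset.inE -ltnNge ler_nat.
  rewrite [leRHS](bigID (mem G)) /= -[leLHS]add0r lerD ?sumr_ge0//.
  rewrite le_eqVlt; apply/orP; left; apply/eqP.
  by apply: eq_bigl => s; rewrite !finset.inE.
rewrite -(ler_nat R) natrM.
have K0 : (0 : R) < (2 * K).+1%:R by rewrite ltr0n.
have a0 : (0 : R) <= (#|P|)`!%:R by exact: ler0n.
suff : 2 * ((#|P|)`!%:R - #|G|%:R) <= (#|P|)`!%:R :> R by lra.
rewrite -(ler_pM2l K0) mulrCA.
apply: le_trans (ler_wpM2l _ low) _ => //.
by rewrite mulrA ler_wpM2r// -natrM ler_nat leqnSn.
Qed.

Lemma simple_conf_transfer (d : nat) (e : R) : 0 < e ->
  exists N0 : nat, forall (V P : finType) (ver : P -> V) (tw : P -> P)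
    (f : {perm P} -> R),
  involutive tw -> (forall x, tw x != x) ->
  (forall v, #|[set p | ver p == v]| = d) -> (N0 <= #|P|)%N ->
  tperm_lipschitz 2 f ->
  simple_conf ver tw != finset.set0 /\
  `|uniform_mean (simple_conf ver tw) f - uniform_mean [set: {perm P}] f|
    <= e * #|P|%:R.
Proof.
(* [1 / 4] meets the condition [2 * (lam * 2) <= 1]; [e / 64] makes the variance term [32 lam] at
   most [e / 2], and [eta / lam] is the other half. *)
move=> e0; pose lam := Num.min (4^-1) (e / 64).
have l0 : 0 < lam by rewrite lt_min invr_gt0 divr_gt0 /= ?ltr0n.
have l1 : lam <= 4^-1 by rewrite ge_min lexx.
have l2 : lam <= e / 64 by rewrite ge_min lexx orbT.
pose J := (2 * (2 * d + 4 * (d * d)))%N.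
have [N1 hN1] := poly_le_expR J (mulr_gt0 l0 (divr_gt0 e0 (ltr0Sn R 1))).
exists (maxn N1 (6 + 4 * d + 2 * (d * d) + J)) => V P ver tw f twK tw_neq cv.
rewrite geq_max => /andP[/hN1 hN big] lip.
have cs := card_simple_conf twK tw_neq cv big.
have S0 : simple_conf ver tw != finset.set0.
  rewrite -card_gt0 lt0n; apply: contraTneq cs => ->.
  by rewrite muln0 leqn0 -lt0n fact_gt0.
split => //.
have := @mean_subset_dist R P 2 lam (lam * (e / 2) * #|P|%:R) _ f lip _ l0 _ S0.
have -> : lam * (e / 2) * #|P|%:R / lam = e / 2 * #|P|%:R.
  by field; rewrite gt_eqF.
move=> H; apply: le_trans (H _ _ _) _; first by [].
- by lra.
- apply: le_trans (_ : (2 * (#|P| * #|P|) ^ J)%N%:R * #|simple_conf ver tw|%:R <= _).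
    by rewrite -natrM ler_nat.
  by rewrite ler_wpM2r.
rewrite -mulrDl ler_wpM2r//; lra.
Qed.

End SimpleTransfer.

(** * Blocks of vertices *)

Section StandardPairing.
Variables (n d : nat).
Hypothesis n_even : ~~ odd n.
Local Notation P := ('I_n * 'I_d)%type.

(** Matches [2i] with [2i + 1]; since [n] is even, the default value of [insubd] is never taken. *)
Definition mate (v : 'I_n) : 'I_n := insubd v (if odd v then v.-1 else v.+1).

Lemma val_mate (v : 'I_n) : mate v = (if odd v then v.-1 else v.+1) :> nat.
Proof.
rewrite val_insubd; case: ifP => // /negbT; rewrite -leqNgt => h; exfalso.
case: v h => v vn /=; case: ifP => ov h; first by lia.
have : v.+1 = n by lia.
by move=> E; move: n_even; rewrite -E /= ov.
Qed.

Lemma odd_mate v : odd (mate v) = ~~ odd v.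
Proof.
rewrite val_mate; case: ifP => ov /=; last by rewrite ov.
by case: (nat_of_ord v) ov => //= u /negbTE ->.
Qed.

Lemma mateK : involutive mate.
Proof.
move=> v; apply: val_inj; rewrite [LHS]val_mate odd_mate val_mate.
by case: (boolP (odd v)) => //=; case: (nat_of_ord v).
Qed.

Lemma mate_neq v : mate v != v.
Proof. by apply/eqP => e; have := odd_mate v; rewrite e; case: odd. Qed.

Definition twin (p : P) : P := (mate p.1, p.2).

Lemma twinK : involutive twin.
Proof. by case=> v a; rewrite /twin /= mateK. Qed.

Lemma twin_neq p : twin p != p.
Proof. by case: p => v a; rewrite /twin xpair_eqE negb_and mate_neq. Qed.

Lemma card_points v : #|[set p : P | p.1 == v]| = d.
Proof.
rewrite -[RHS]card_ord -(card_imset (f := fun a : 'I_d => (v, a))); last by move=> a b [].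
apply: eq_card => -[u a]; rewrite !finset.inE /=; apply/eqP/imsetP => [->|[b _ [-> _]]] //.
by exists a.
Qed.

Definition even_points : seq P := [seq p : P <- enum {: P} | ~~ odd p.1].

Definition pairing : seq (P * P) := [seq (p, twin p) | p <- even_points].

Lemma pairing_perm : perm_eq (pts pairing) (enum {: P}).
Proof.
have memP p : p \in pts pairing.
  rewrite /pts; apply/flattenP; have [op|op] := boolP (odd p.1).
    exists [:: twin p; twin (twin p)]; last by rewrite twinK !inE eqxx orbT.
    apply/mapP; exists (twin p, twin (twin p)) => //; apply/mapP; exists (twin p) => //.
    by rewrite mem_filter mem_enum /= odd_mate op.
  exists [:: p; twin p]; last by rewrite !inE eqxx.
  apply/mapP; exists (p, twin p) => //; apply/mapP; exists p => //.
  by rewrite mem_filter mem_enum /= op.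
apply: uniq_perm => [||p]; [|exact: enum_uniq|by rewrite memP mem_enum].
have : uniq even_points by rewrite filter_uniq ?enum_uniq.
have : all (fun p : P => ~~ odd p.1) even_points by exact: filter_all.
rewrite /pairing; elim: even_points => //= p t IH /andP[op ot] /andP[pt ut].
rewrite -[flatten _]/(pts _) IH // andbT.
have sub q : q \in pts [seq (p, twin p) | p <- t] -> (if odd q.1 then twin q else q) \in t.
  rewrite /pts => /flattenP[_ /mapP[_ /mapP[u ut' ->] ->]].
  have ou := allP ot _ ut'; rewrite !inE => /orP[]/eqP ->; first by rewrite (negbTE ou).
  by rewrite odd_mate ou twinK.
rewrite inE negb_or eq_sym twin_neq /=; apply/andP; split.
  by apply: contra pt => /sub; rewrite (negbTE op).
by apply: contra pt => /sub; rewrite odd_mate op twinK.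
Qed.

End StandardPairing.

(** Each flip pulls the running sum back towards half of [k * m]: the doubled discrepancy moves by
    [|m - 2 a c|], at most [m], against its current sign. *)
Lemma balancing_flips (m k : nat) (a : nat -> nat) : (forall c, a c <= m)%N ->
  exists f : nat -> bool,
    (k * m <= 2 * (\sum_(c < k) if f c then m - a c else a c) + m)%N /\
    (2 * (\sum_(c < k) if f c then m - a c else a c) <= k * m + m)%N.
Proof.
move=> am; elim: k => [|k [f [f1 f2]]].
  by exists (fun=> false); rewrite big_ord0.
set S := \sum_(c < k) _ in f1 f2.
pose b := (k * m <= 2 * S)%N == (m <= 2 * a k)%N.
exists (fun c => if c == k then b else f c).
rewrite big_ord_recr /= eqxx.
have -> : (\sum_(i < k) (if (if i == k :> nat then b else f i) then m - a i else a i) = S)%N.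
  by apply: eq_bigr => i _; rewrite ltn_eqF.
have := am k; rewrite /b mulSn {b}; move: (k * m)%N (a k) S f1 f2 => km ak S f1 f2 akm.
by case: (leqP km (2 * S)) => ?; case: (leqP m (2 * ak)) => ? /=; lia.
Qed.

Section Blocks.
Variables (m k n d : nat).
Hypothesis m_gt0 : (0 < m)%N.
Hypothesis m_even : ~~ odd m.
Hypothesis n_even : ~~ odd n.
Hypothesis kmn : (k * m + m <= n)%N.
Hypothesis nkm : (n < k * m + m + m)%N.
Local Notation Pn := ('I_n * 'I_d)%type.
Local Notation Pm := ('I_m * 'I_d)%type.

(* Colour k collects the n - k * m >= m vertices left over, which are free to
   balance the union of the flipped cuts of the other blocks. *)
Definition block (p : Pn) : 'I_k.+1 := inord (minn (p.1 %/ m) k).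

Lemma vemb_subproof (c : 'I_k) (i : 'I_m) : (c * m + i < n)%N.
Proof.
apply: leq_trans kmn; have := ltn_ord c; have := ltn_ord i => im ck.
apply: leq_trans (_ : c * m + m <= _)%N; first by rewrite ltn_add2l.
by rewrite leq_add2r leq_mul2r (ltnW ck) orbT.
Qed.

Definition vemb (c : 'I_k) (i : 'I_m) : 'I_n := Ordinal (vemb_subproof c i).

Definition emb (c : 'I_k) (p : Pm) : Pn := (vemb c p.1, p.2).

Definition block_proj (p : Pn) : Pm := (Ordinal (ltn_pmod p.1 m_gt0), p.2).

Lemma embK c : cancel (emb c) block_proj.
Proof.
move=> [i a]; rewrite /block_proj /emb /=; congr (_, _); apply: val_inj => /=.
by rewrite modnMDl modn_small.
Qed.

Lemma div_vemb c i : (vemb c i %/ m)%N = c.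
Proof. by rewrite /= divnMDl // divn_small ?addn0. Qed.

Lemma block_emb (c : 'I_k) p : block (emb c p) = widen_ord (leqnSn k) c.
Proof.
apply: val_inj; rewrite /= /block /= -/(vemb c p.1) div_vemb.
rewrite inordK ?ltnS ?geq_minr //; apply/minn_idPl; exact: ltnW.
Qed.

Lemma emb_proj (c : 'I_k) p : block p = widen_ord (leqnSn k) c -> emb c (block_proj p) = p.
Proof.
move=> /(congr1 val); rewrite /= /block inordK ?ltnS ?geq_minr // => h.
have {}h : (p.1 %/ m)%N = c.
  by move: h (ltn_ord c); rewrite /minn; case: ifP => // _ <-; rewrite ltnn.
case: p h => v a /= h; congr (_, _); apply: val_inj => /=.
by rewrite -h -divn_eq.
Qed.

Lemma twin_emb c p : twin (emb c p) = emb c (twin p).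
Proof.
rewrite /twin /emb /=; congr (_, _); apply: val_inj; rewrite /= !val_mate //=.
rewrite oddD oddM (negbTE m_even) andbF /=; case: ifP => o; last by rewrite addnS.
by case: (nat_of_ord p.1) o => // u _; rewrite addnS.
Qed.

Lemma vemb_inj c c' i i' : vemb c i = vemb c' i' -> c = c' /\ i = i'.
Proof.
move=> e; have cc : c = c' by apply: val_inj; rewrite /= -(div_vemb c i) e div_vemb.
split => //; move/(congr1 val): e; rewrite /= cc => /addnI; exact: val_inj.
Qed.

(** The flipped sets miss half of [k * m] by at most [m / 2], and at least [m] vertices lie outside
    the blocks, so a subset [Y] of these completes the union to size [n / 2]. *)
Lemma exists_bisection (Sm : 'I_k -> {set 'I_m}) :
  exists (S : {set 'I_n}) (f : 'I_k -> bool), #|S| = n./2 /\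
    forall c i, (vemb c i \in S) = (i \in Sm c) (+) f c.
Proof.
pose a c := if insub c is Some c' then #|Sm c'| else 0%N.
have am c : (a c <= m)%N.
  by rewrite /a; case: insub => // c'; rewrite -[leqRHS]card_ord max_card.
have [f [f1 f2]] := balancing_flips k am.
pose h (p : 'I_k * 'I_m) := vemb p.1 p.2.
have hI : injective h by move=> [c i] [c' i'] /vemb_inj /= [-> ->].
pose T := [set p : 'I_k * 'I_m | (p.2 \in Sm p.1) (+) f p.1].
have cT : #|T| = (\sum_(c < k) if f c then m - a c else a c)%N.
  rewrite -sum1_card (eq_bigl (fun p => true && ((p.2 \in Sm p.1) (+) f p.1))); last first.
    by move=> p; rewrite finset.inE.
  rewrite -(pair_big_dep predT (fun c i => (i \in Sm c) (+) f c) (fun _ _ => 1%N)) /=.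
  apply: eq_bigr => c _; rewrite sum1_card.
  have ac : a c = #|Sm c| by rewrite /a valK.
  rewrite ac; case: (f c).
    rewrite -[X in (X - _)%N](card_ord m) -(cardsC (Sm c)) addKn.
    by apply: eq_card => i; rewrite [RHS]finset.inE unfold_in /= addbT.
  by apply: eq_card => i; rewrite unfold_in /= addbF.
have cX : #|~: [set h p | p : 'I_k * 'I_m]| = (n - k * m)%N.
  by rewrite cardsCs finset.setCK card_imset // card_prod !card_ord.
have [Y YX Yc] : exists2 Y : {set 'I_n}, Y \subset ~: [set h p | p : 'I_k * 'I_m] &
    #|Y| = (n./2 - #|T|)%N.
  apply: exists_subset; rewrite cX cT.
  by move: f1 f2 kmn n_even; move: (\sum_(c < k) _)%N (k * m)%N => u v; lia.
exists ((h @: T) :|: Y), f; split.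
  rewrite cardsU (_ : _ :&: Y = finset.set0) ?cards0 ?subn0; last first.
    apply/setP => v; rewrite finset.in_setI finset.in_set0.
    apply/negP => /andP[/imsetP[p _ ->] /(fintype.subsetP YX)].
    by rewrite finset.in_setC imset_f.
  rewrite card_imset // Yc subnKC // cT.
  by move: f1 f2 kmn n_even; move: (\sum_(c < k) _)%N (k * m)%N => u v; lia.
move=> c i; rewrite finset.inE -[vemb c i]/(h (c, i)) mem_imset // finset.inE /=.
rewrite orbC; case: (boolP (h (c, i) \in Y)) => // /(fintype.subsetP YX).
by rewrite finset.inE imset_f.
Qed.

Lemma maxsep_blocks (s : {perm Pn}) (t : 'I_k -> {perm Pm}) :
  (forall c p, s (emb c p) = emb c (t c p)) ->
  (\sum_(c < k) maxsep [set: {set 'I_m}] (vercol (fun p => p.1)) (emap (t c) (pairing m d)) <=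
   maxsep [set S : {set 'I_n} | #|S| == (#|'I_n|)./2] (vercol (fun p => p.1))
     (emap s (pairing n d)))%N.
Proof.
move=> st.
have ex c : exists S : {set 'I_m},
    maxsep [set: {set 'I_m}] (vercol (fun p => p.1)) (emap (t c) (pairing m d)) ==
    count (sep (vercol (fun p => p.1)) S) (emap (t c) (pairing m d)).
  rewrite /maxsep; have [|S _ ->] := @eq_bigmax_cond _ (mem [set: {set 'I_m}])
    (fun S => count (sep (vercol (fun p => p.1)) S) (emap (t c) (pairing m d))).
    by apply/card_gt0P; exists finset.set0; rewrite finset.inE.
  by exists S.
pose Sm c := xchoose (ex c).
have [S [f [Sn Sf]]] := exists_bisection Sm.
apply: leq_trans (_ : count (sep (vercol (fun p => p.1)) S) (emap s (pairing n d)) <= _)%N;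
  last by apply: leq_bigmax_cond; rewrite finset.inE card_ord Sn.
rewrite (count_sep_conf (fun p => p.1) (@twinK n d n_even) (pairing_perm d n_even)).
pose D c := [set p : Pm | (((t c p).1 \in Sm c) (+) f c) && ~~ (((t c (twin p)).1 \in Sm c) (+) f c)].
have cD c : maxsep [set: {set 'I_m}] (vercol (fun p => p.1)) (emap (t c) (pairing m d)) = #|D c|.
  rewrite (eqP (xchooseP (ex c))) -/(Sm c).
  rewrite (count_sep_conf (fun p => p.1) (@twinK m d m_even) (pairing_perm d m_even)).
  rewrite /D; case: (f c).
    have tI := inv_inj (@twinK m d m_even).
    rewrite -(card_preimset _ tI); apply: eq_card => p.
    by rewrite !inE (twinK m_even) !addbT negbK andbC.
  by apply: eq_card => p; rewrite !inE !addbF.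
under eq_bigr do rewrite cD.
pose h (q : 'I_k * Pm) := emb q.1 q.2.
have hI : injective h.
  move=> [c [i a]] [c' [i' a']] /= e; have /vemb_inj[/= cc ii] := congr1 fst e.
  have /= aa := congr1 snd e; by rewrite cc ii aa.
have -> : (\sum_(c < k) #|D c| = #|[set q : 'I_k * Pm | q.2 \in D q.1]|)%N.
  rewrite -[RHS]sum1_card (eq_bigl (fun q => true && (q.2 \in D q.1))); last first.
    by move=> q; rewrite finset.inE.
  rewrite -(pair_big_dep predT (fun c p => p \in D c) (fun _ _ => 1%N)) /=.
  by apply: eq_bigr => c _; rewrite sum1_card.
rewrite -(card_imset _ hI); apply: subset_leq_card; apply/fintype.subsetP => _ /imsetP[[c p] + ->].
rewrite !finset.inE /h /= => /andP[h1 h2].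
rewrite twin_emb !st /= !Sf h1 /=; exact: h2.
Qed.

Lemma block_size_block (c : 'I_k.+1) :
  (m * d <= block_size block c <= (m * d).*2)%N.
Proof.
rewrite /block_size.
have vcard (Q : pred 'I_n) : #|[set p : Pn | Q p.1]| = (#|[set v | Q v]| * d)%N.
  rewrite (_ : [set p : Pn | Q p.1] = finset.setX [set v | Q v] [set: 'I_d]).
    by rewrite cardsX cardsT card_ord.
  by apply/setP => -[v a]; rewrite !finset.inE /= andbT.
have E : [set p : Pn | block p == c] = [set p : Pn | minn (p.1 %/ m) k == c].
  apply/setP => p; rewrite !finset.inE -val_eqE /= /block inordK // ltnS geq_minr //.
rewrite E (vcard (fun v => minn (v %/ m) k == c)) -muln2 -mulnA [(d * 2)%N]mulnC mulnA.
suff : (m <= #|[set v : 'I_n | minn (v %/ m) k == c]| <= m * 2)%N.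
  by move=> /andP[h1 h2]; rewrite !leq_mul2r h1 h2 !orbT.
have [ck|ck] := ltnP c k.
  have -> : [set v : 'I_n | minn (v %/ m) k == c] = [set vemb (Ordinal ck) i | i : 'I_m].
    apply/setP => v; rewrite finset.inE; apply/eqP/imsetP => [h|[i _ ->]].
      exists (Ordinal (ltn_pmod v m_gt0)) => //; apply: val_inj => /=.
      have vc : (v %/ m = c)%N by move: h ck; rewrite /minn; case: ifP => // _ <-; rewrite ltnn.
      by rewrite -vc -divn_eq.
    by rewrite div_vemb; apply/minn_idPl; exact: ltnW.
  rewrite card_imset ?card_ord; last by move=> i i' /vemb_inj[].
  by rewrite leqnn leq_pmulr.
have {ck} cE : c = k :> nat by apply/eqP; rewrite eqn_leq ck -ltnS ltn_ord.
have -> : [set v : 'I_n | minn (v %/ m) k == c] =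
    ~: [set vemb p.1 p.2 | p : 'I_k * 'I_m].
  apply/setP => v; rewrite !finset.inE cE; apply/eqP/negP => [h /imsetP[p _ vE]|h].
    move: h; rewrite vE div_vemb => /minn_idPr; by rewrite leqNgt ltn_ord.
  apply/minn_idPr; rewrite leqNgt; apply/negP => vk; apply: h.
  apply/imsetP; exists (Ordinal vk, Ordinal (ltn_pmod v m_gt0)) => //.
  by apply: val_inj; rewrite /= -divn_eq.
rewrite cardsCs finset.setCK card_imset; last first.
  by move=> [c1 i] [c2 i'] /vemb_inj /= [-> ->].
rewrite card_prod !card_ord leq_subRL ?(leq_trans (leq_addr m _) kmn) // kmn /=.
by rewrite leq_subLR muln2 -addnn addnA ltnW.
Qed.

Section MeanOverBlocks.
Variable R : realType.

Definition block_embed_fun (c : 'I_k) (t : {perm Pm}) (p : Pn) : Pn :=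
  if block p == widen_ord (leqnSn k) c then emb c (t (block_proj p)) else p.

Lemma block_embed_inj c t : injective (block_embed_fun c t).
Proof.
apply: (can_inj (g := block_embed_fun c t^-1%g)) => p; rewrite /block_embed_fun.
have [bp|bp] := eqVneq (block p) (widen_ord (leqnSn k) c).
  by rewrite block_emb eqxx embK permK emb_proj.
by rewrite (negbTE bp).
Qed.

Definition block_embed c t : {perm Pn} := perm (@block_embed_inj c t).

Lemma block_embedP c t : block_embed c t \in block_perms block.
Proof.
apply/block_permsP => p; rewrite permE /block_embed_fun.
by case: eqP => // ->; rewrite block_emb.
Qed.

Definition restrict_fun (c : 'I_k) (s : {perm Pn}) (p : Pm) : Pm := block_proj (s (emb c p)).

Lemma restrict_funK c s p : s \in block_perms block ->
  emb c (restrict_fun c s p) = s (emb c p).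
Proof. by move=> /block_permsP sb; rewrite emb_proj // sb block_emb. Qed.

Lemma restrict_perm c s : s \in block_perms block ->
  exists t : {perm Pm}, forall p, t p = restrict_fun c s p.
Proof.
move=> sb; have inj : injective (restrict_fun c s).
  move=> p q /(congr1 (emb c)); rewrite !restrict_funK // => /perm_inj.
  exact: (can_inj (embK c)).
by exists (perm inj) => p; rewrite permE.
Qed.

Let cut_m (g : Pm -> Pm) : R :=
  (maxsep [set: {set 'I_m}] (vercol (fun p => p.1)) (emap g (pairing m d)))%:R.

Let permsT0 : [set: {perm Pm}] != finset.set0.
Proof. by apply/set0Pn; exists 1%g; rewrite finset.inE. Qed.

(** An independent uniform [t] on block [c] is inserted: [s] absorbs it, and after exchanging the
    means [t] absorbs the restriction of [s]. *)
Lemma mean_restrict c :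
  uniform_mean (block_perms block) (fun s => cut_m (restrict_fun c s)) =
  uniform_mean [set: {perm Pm}] (fun t => cut_m t).
Proof.
rewrite -[LHS](mean_cst _ permsT0).
transitivity (uniform_mean [set: {perm Pm}] (fun t =>
    uniform_mean (block_perms block) (fun s => cut_m (fun p => restrict_fun c s (t p))))).
  apply: eq_mean => t _; rewrite -(mean_block_permsM _ (block_embedP c t)).
  apply: eq_mean => s _; congr (maxsep _ _ _)%:R; apply: eq_map => e.
  by rewrite /restrict_fun !permM !permE /block_embed_fun !block_emb eqxx !embK.
rewrite mean_exchange -[RHS](mean_cst _ (block_perms_neq0 block)).
apply: eq_mean => s sb; have [u uE] := restrict_perm c sb.
rewrite -[RHS](mean_reindex _ (h := fun t => (t * u)%g)); last 2 first.
- exact: mulIg.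
- by move=> t; rewrite !finset.inE.
apply: eq_mean => t _ /=; congr (maxsep _ _ _)%:R; apply: eq_map => e.
by rewrite !permM !uE.
Qed.

Lemma block_mean_ge :
  k%:R * uniform_mean [set: {perm Pm}] (fun t => cut_m t) <=
  block_mean R [set S : {set 'I_n} | #|S| == (#|'I_n|)./2] (vercol (fun p => p.1))
    block (pairing n d).
Proof.
rewrite -[k in k%:R]card_ord mulr_natl -sumr_const.
apply: le_trans (_ : uniform_mean (block_perms block)
  (fun s => \sum_(c < k) cut_m (restrict_fun c s)) <= _).
  by rewrite mean_sum; apply: ler_sum => c _; rewrite mean_restrict.
apply: ler_mean => s sb.
have [t tE] : exists t : 'I_k -> {perm Pm}, forall c p, t c p = restrict_fun c s p.
  have ex c : exists t : {perm Pm}, [forall p, t p == restrict_fun c s p].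
    by have [t tE] := restrict_perm c sb; exists t; apply/forallP => p; rewrite tE.
  by exists (fun c => xchoose (ex c)) => c p; apply/eqP; move: p; apply/forallP; exact: xchooseP (ex c).
rewrite -natr_sum ler_nat; apply: leq_trans (maxsep_blocks (t := t) _).
  apply: leq_sum => c _; rewrite leq_eqVlt; apply/orP; left; apply/eqP.
  by congr (maxsep _ _ _); apply: eq_map => e; rewrite !tE.
by move=> c p; rewrite tE restrict_funK.
Qed.

End MeanOverBlocks.
End Blocks.

(** * Comparing bisections with cuts *)

Section Comparison.
Variables (R : realType) (d : nat).
Hypothesis d_gt0 : (0 < d)%N.

Let cuts n (s : {perm 'I_n * 'I_d}) : R :=
  (maxsep [set: {set 'I_n}] (vercol (fun p => p.1)) (emap s (pairing n d)))%:R.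

Let bisections n (s : {perm 'I_n * 'I_d}) : R :=
  (maxsep [set S : {set 'I_n} | #|S| == (#|'I_n|)./2] (vercol (fun p => p.1))
    (emap s (pairing n d)))%:R.

Let simple n := simple_conf (fun p : 'I_n * 'I_d => p.1) (@twin n d).

Lemma uniq_pairing n : ~~ odd n -> uniq (pts (pairing n d)).
Proof. by move=> ne; rewrite (perm_uniq (pairing_perm d ne)) enum_uniq. Qed.

Lemma size_pairing n : ~~ odd n -> (size (pairing n d) <= n * d)%N.
Proof.
move=> ne; have := perm_size (pairing_perm d ne).
rewrite size_pts -cardE card_prod !card_ord => <-.
by rewrite -addnn leq_addr.
Qed.

Lemma mean_regular_conf n (f : {set {set 'I_n}} -> R) : ~~ odd n -> (d < n)%N ->
  uniform_mean (regular_graphs n d) f =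
  uniform_mean (simple n) (fun s => f (conf_graph (fun p => p.1) (@twin n d) s)).
Proof.
move=> ne dn; have n0 : (0 < n)%N by apply: leq_ltn_trans dn.
by rewrite (mean_simple_conf (@twinK n d ne) (@twin_neq n d ne) (@card_points n d)
  (pairing_perm d ne) (Ordinal n0, Ordinal d_gt0)).
Qed.

Lemma E_MaxCut_conf n : ~~ odd n -> (d < n)%N ->
  E_MaxCut R d n = uniform_mean (simple n) (@cuts n).
Proof.
move=> ne dn; rewrite /E_MaxCut mean_regular_conf//; apply: eq_mean => s ss.
by rewrite (MaxCut_conf (@twinK n d ne) (@twin_neq n d ne) (pairing_perm d ne) ss).
Qed.

Lemma E_MaxBis_conf n : ~~ odd n -> (d < n)%N ->
  E_MaxBis R d n = uniform_mean (simple n) (@bisections n).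
Proof.
move=> ne dn; rewrite /E_MaxBis mean_regular_conf//; apply: eq_mean => s ss.
by rewrite (MaxBis_conf (@twinK n d ne) (@twin_neq n d ne) (pairing_perm d ne) ss).
Qed.

Lemma E_MaxBis_le n : E_MaxBis R d n <= E_MaxCut R d n.
Proof.
apply: ler_mean => E _; rewrite ler_nat.
by apply/bigmax_leqP => S _; exact: leq_bigmax_cond.
Qed.

Lemma E_MaxBis_ge0 n : 0 <= E_MaxBis R d n.
Proof. by rewrite divr_ge0 ?sumr_ge0. Qed.

(** An inner block is a union of matched pairs because [m] is even; the leftover block follows since
    [twin] is an involution. *)
Lemma block_twin m k n (m_gt0 : (0 < m)%N) : ~~ odd m -> ~~ odd n ->
  (k * m + m <= n)%N ->
  forall p : 'I_n * 'I_d, block m k (twin p) = block m k p.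
Proof.
move=> me ne kmn.
have inner c (q : 'I_n * 'I_d) : block m k q = widen_ord (leqnSn k) c ->
    block m k (twin q) = widen_ord (leqnSn k) c :> 'I_k.+1.
  by move=> /(emb_proj m_gt0 kmn) <-; rewrite (twin_emb me ne) block_emb.
have outer (c : 'I_k.+1) : (exists c', c = widen_ord (leqnSn k) c') \/ c = ord_max.
  have [ck|ck] := ltnP c k; first by left; exists (Ordinal ck); apply: val_inj.
  by right; apply: val_inj; apply/eqP; rewrite eqn_leq ck -ltnS ltn_ord.
move=> p; have [[c pc]|pk] := outer (block m k p); first by rewrite pc; exact: inner.
have [[c pc]|->] := outer (block m k (twin p)); last by rewrite pk.
by have := inner _ _ pc; rewrite (twinK ne) => ->.
Qed.

(** A uniform permutation followed by a colour-preserving one is still uniform. This is how an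
    inequality for fixed pairings and blocks reaches the configuration model. *)
Lemma mean_block_mean n (k : nat) (b : 'I_n * 'I_d -> 'I_k.+1) :
  uniform_mean [set: {perm 'I_n * 'I_d}] (fun s =>
    block_mean R [set S : {set 'I_n} | #|S| == (#|'I_n|)./2] (vercol (fun p => p.1)) b
      (emap s (pairing n d))) =
  uniform_mean [set: {perm 'I_n * 'I_d}] (@bisections n).
Proof.
rewrite mean_exchange -[RHS](mean_cst _ (block_perms_neq0 b)).
apply: eq_mean => t _; rewrite -[RHS](mean_reindex _ (h := fun s => (s * t)%g)).
- by apply: eq_mean => s _; rewrite /= /bisections emap_permM.
- exact: mulIg.
- by move=> s; rewrite !finset.inE.
Qed.

Lemma bisections_ge_cuts (e : R) : 0 < e -> exists M0 : nat,
  forall m n : nat, (M0 <= m)%N -> ~~ odd m -> ~~ odd n -> (0 < m)%N -> (m <= n)%N ->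
  (n %/ m).-1%:R * uniform_mean [set: {perm 'I_m * 'I_d}] (@cuts m) <=
  uniform_mean [set: {perm 'I_n * 'I_d}] (@bisections n) + e * (n * d)%N%:R.
Proof.
move=> e0; have [M0 hM0] := interpolation e0.
(* One block fewer than fits, so that the leftover block has at least [m] and fewer than [2m]
   vertices. *)
exists M0 => m n M0m me ne m0 mn; set k := (n %/ m).-1.
have kE : (k.+1 = n %/ m)%N by rewrite prednK // divn_gt0.
have kmn : (k * m + m <= n)%N by rewrite addnC -mulSn kE leq_trunc_div.
have nkm : (n < k * m + m + m)%N.
  by rewrite [(k * m + m)%N]addnC -mulSn kE addnC -mulSn ltn_ceil.
apply: le_trans (block_mean_ge d m0 me ne kmn nkm R) _.
have -> : e * (n * d)%N%:R = e * #|{: 'I_n * 'I_d}|%:R by rewrite card_prod !card_ord.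
rewrite -(mean_block_mean (@block m k n d)) -meanDc; last first.
  by apply/set0Pn; exists 1%g; rewrite finset.inE.
set B := block_mean _ _ _ _ _.
rewrite -[leLHS](mean_cst _ (_ : [set: {perm 'I_n * 'I_d}] != finset.set0)); last first.
  by apply/set0Pn; exists 1%g; rewrite finset.inE.
apply: ler_mean => s _; apply: (hM0 (m * d)%N).
- by apply: leq_trans M0m _; rewrite leq_pmulr.
- have [S [_ [Sn _]]] := exists_bisection m0 me ne kmn nkm (fun=> finset.set0).
  by apply/set0Pn; exists S; rewrite finset.inE card_ord Sn.
- exact: block_size_block.
- rewrite pts_emap; apply: uniq_perm; rewrite ?enum_uniq //.
    by rewrite map_inj_uniq ?uniq_pairing //; exact: perm_inj.
  move=> p; rewrite mem_enum; apply/mapP; exists (s^-1%g p); last by rewrite permKV.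
  by rewrite (perm_mem (pairing_perm d ne)) mem_enum.
- exact: pairing_perm.
- by rewrite all_map; apply/allP => p _ /=; rewrite (block_twin m0 me ne kmn).
Qed.

Lemma MaxBis_vs_MaxCut (e : R) : 0 < e -> exists m0 : nat,
  forall m : nat, (m0 <= m)%N -> ~~ odd m -> (d < m)%N ->
    E_MaxCut R d m / m%:R <= d%:R /\
    exists n0 : nat, forall n : nat, (n0 <= n)%N -> ~~ odd n -> (d < n)%N ->
      E_MaxCut R d m / m%:R - e <= E_MaxBis R d n / n%:R.
Proof.
move=> e0; have d0 : (0 : R) < d%:R by rewrite ltr0n.
(* Errors of [e / 6] per vertex come from the interpolation and from both transfers to simple
   graphs; dividing by [d] converts points into vertices. The remaining [e / 2] is for the leftover
   block. *)
pose h := e / (6 * d%:R).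
have h0 : 0 < h by rewrite divr_gt0 ?mulr_gt0.
have [N1 hN1] := simple_conf_transfer d h0.
have [M0 hM0] := bisections_ge_cuts h0.
have transfer n (A : {set {set 'I_n}}) (f := fun s : {perm 'I_n * 'I_d} =>
      (maxsep A (vercol (fun p => p.1)) (emap s (pairing n d)))%:R : R) :
    (N1 <= n)%N -> ~~ odd n ->
    simple n != finset.set0 /\
    `|uniform_mean (simple n) f - uniform_mean [set: {perm 'I_n * 'I_d}] f| <= h * (n * d)%N%:R.
  move=> Nn ne.
  have -> : h * (n * d)%N%:R = h * #|{: 'I_n * 'I_d}|%:R by rewrite card_prod !card_ord.
  apply: (hN1 _ _ (fun p : 'I_n * 'I_d => p.1) (@twin n d) f).
  - exact: twinK.
  - exact: twin_neq.
  - exact: card_points.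
  - by rewrite card_prod !card_ord; apply: leq_trans Nn _; rewrite leq_pmulr.
  - by apply: maxsep_tperm_lipschitz; exact: uniq_pairing.
exists (maxn M0 N1) => m; rewrite geq_max => /andP[M0m N1m] me dm.
have m0 : (0 < m)%N by exact: leq_ltn_trans dm.
have mR : (0 : R) < m%:R by rewrite ltr0n.
have [S0 tm] := transfer m [set: {set 'I_m}] N1m me.
rewrite -/(@cuts m) -E_MaxCut_conf // in tm.
have xd : E_MaxCut R d m <= m%:R * d%:R.
  rewrite E_MaxCut_conf // -[leRHS](mean_cst _ S0); apply: ler_mean => s _.
  rewrite -natrM ler_nat; apply/bigmax_leqP => S _.
  by apply: leq_trans (count_size _ _) _; rewrite size_map size_pairing.
have x0 : 0 <= E_MaxCut R d m := le_trans (E_MaxBis_ge0 m) (E_MaxBis_le m).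
split; first by rewrite ler_pdivrMr // mulrC.
set x := E_MaxCut R d m in tm xd x0 *.
(* Makes the loss of up to [2 m] vertices, worth at most [2 m d], no larger than [e n / 2]. *)
exists (maxn (maxn m N1) (Num.truncn (4 * (m%:R * d%:R) / e)).+1) => n.
rewrite !geq_max => /andP[/andP[mn N1n] nbig] ne dn.
have n_gt0 : (0 < n)%N by exact: leq_ltn_trans dn.
have nR : (0 : R) < n%:R by rewrite ltr0n.
have [_ tn] := transfer n [set S : {set 'I_n} | #|S| == (#|'I_n|)./2] N1n ne.
rewrite -/(@bisections n) -E_MaxBis_conf // in tn.
have key := hM0 m n M0m me ne m0 mn.
set k := (n %/ m).-1 in key.
set y := E_MaxBis R d n in tn *.
set U := uniform_mean _ (@bisections n) in tn key.
set D := uniform_mean _ (@cuts m) in tm key.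
have md : 4 * (m%:R * d%:R) <= e * n%:R.
  rewrite -ler_pdivrMl // mulrC; apply: le_trans (ltW (truncnS_gt _)) _.
  by rewrite ler_nat.
have kE : (k.+1 = n %/ m)%N by rewrite prednK // divn_gt0.
have km1 : k%:R * m%:R <= n%:R :> R.
  by rewrite -natrM ler_nat; apply: leq_trans (leq_trunc_div n m); rewrite -kE leq_mul2r leqnSn orbT.
have km2 : n%:R <= k%:R * m%:R + 2 * m%:R :> R.
  rewrite -!natrM -natrD ler_nat -mulnDl ltnW //.
  by rewrite addn2 kE ltn_ceil.
have hd : h * d%:R = e / 6 by rewrite /h; field; rewrite gt_eqF.
have hE j : h * (j * d)%N%:R = e / 6 * j%:R by rewrite natrM mulrCA hd mulrC.
have tm' : D >= x - e / 6 * m%:R.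
  move: tm; rewrite hE ler_norml => /andP[_]; lra.
have tn' : y >= U - e / 6 * n%:R.
  move: tn; rewrite hE ler_norml => /andP[+ _]; lra.
have key' : k%:R * D <= U + e / 6 * n%:R.
  by move: key; rewrite hE.
have kD : k%:R * x - e / 6 * (k%:R * m%:R) <= k%:R * D.
  apply: le_trans (ler_wpM2l (ler0n R k) tm'); lra.
have kx : (n%:R - 2 * m%:R) * x <= k%:R * m%:R * x by rewrite ler_wpM2r//; lra.
rewrite lerBlDr ler_pdivrMr // -[x <= _](ler_pM2l nR).
have -> : n%:R * ((y / n%:R + e) * m%:R) = (y + e * n%:R) * m%:R by field; rewrite gt_eqF.
have b1 : 2 * m%:R * x <= m%:R * (2 * (m%:R * d%:R)).
  by rewrite mulrAC mulrC ler_pM2l // ler_pM2l.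
have b2 : m%:R * (2 * (m%:R * d%:R)) <= m%:R * (e * n%:R / 2).
  by rewrite ler_pM2l //; lra.
have b3 : e / 6 * (k%:R * m%:R) <= e / 6 * n%:R by rewrite ler_pM2l // divr_gt0.
have b4 : m%:R * (k%:R * x - e / 6 * n%:R) <= m%:R * (y + e / 3 * n%:R).
  by rewrite ler_pM2l //; lra.
lra.
Qed.

End Comparison.

(** * Existence of the common limit *)

Lemma near_even_infty (d : nat) (Q : nat -> Prop) :
  (exists N : nat, forall n : nat, (N <= n)%N -> ~~ odd n -> (d < n)%N -> Q n) ->
  \forall n \near even_infty d, Q n.
Proof.
move=> [N hN]; rewrite /even_infty /within /=; exists N => //= n /= Nn [ne dn].
exact: hN.
Qed.

Local Open Scope classical_set_scope.
Local Open Scope ring_scope.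

Theorem theorem1p1 (R : realType) (d : nat) (hd : (1 <= d)%N) :
  let F := even_infty d in
  (fun n => E_MaxCut R d n - E_MaxBis R d n : R^o) =o_F
    (fun n => n%:R : R^o) /\
  exists b : R,
    E_MaxCut R d n / n%:R @[n --> F] --> b /\
    E_MaxBis R d n / n%:R @[n --> F] --> b.
Proof.
move=> F.
pose x n : R := E_MaxCut R d n / n%:R; pose y n : R := E_MaxBis R d n / n%:R.
have yx n : y n <= x n by rewrite ler_wpM2r ?invr_ge0 // E_MaxBis_le.
(* Eventual lower bounds of [y]; their supremum, the lower limit of [y] along even [n], is the
   constant [b]. *)
pose X : set R := [set c | exists N : nat, forall n : nat,
  (N <= n)%N -> ~~ odd n -> (d < n)%N -> c <= y n].
have ge_x (e : R) : 0 < e -> exists m0 : nat, forall m : nat,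
    (m0 <= m)%N -> ~~ odd m -> (d < m)%N -> x m <= d%:R /\ X (x m - e).
  move=> e0; have [m0 hm0] := MaxBis_vs_MaxCut hd e0; exists m0 => m m0m me dm.
  by have [? [n0 hn0]] := hm0 m m0m me dm; split => //; exists n0.
have X0 : X 0.
  by exists 0%N => n _ _ _; rewrite divr_ge0 // E_MaxBis_ge0.
have Xd : ubound X d%:R.
  move=> c [N hN]; have [m0 hm0] := ge_x 1 ltr01.
  pose n := (m0 + N + d.+1).*2.
  have nE : ~~ odd n by rewrite odd_double.
  have n2 : (m0 + N + d.+1 <= n)%N by rewrite /n -addnn leq_addr.
  have dn : (d < n)%N by apply: leq_trans n2; rewrite leq_addl.
  have m0n : (m0 <= n)%N by apply: leq_trans n2; rewrite -addnA leq_addr.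
  have Nn : (N <= n)%N by apply: leq_trans n2; rewrite addnAC leq_addl.
  by have [xd _] := hm0 n m0n nE dn; exact: le_trans (le_trans (hN n Nn nE dn) (yx n)) xd.
have supX : has_sup X by split; [exists 0|exists d%:R].
pose b := sup X.
(* For large even [m], [x m - e] belongs to [X], which bounds the upper limit of [x] by [b]; with
   [y <= x] both sequences are squeezed. *)
have limit (e : R) : 0 < e -> exists N : nat, forall n : nat,
    (N <= n)%N -> ~~ odd n -> (d < n)%N -> b - e <= y n /\ x n <= b + e.
  move=> e0; have [c [N1 hN1] bc] := sup_adherent e0 supX.
  have [N2 hN2] := ge_x e e0; exists (maxn N1 N2) => n.
  rewrite geq_max => /andP[n1 n2] ne dn; split.
    by apply: le_trans (hN1 n n1 ne dn); exact: ltW.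
  have [_ /(sup_upper_bound supX)] := hN2 n n2 ne dn.
  by rewrite -lerBlDr.
split; last first.
  exists b; split; apply/cvgrPdist_le => e e0; apply: near_even_infty.
    have [N hN] := limit e e0; exists N => n Nn ne dn; have [h1 h2] := hN n Nn ne dn.
    by rewrite ler_distlC h2 andbT; exact: le_trans h1 (yx n).
  have [N hN] := limit e e0; exists N => n Nn ne dn; have [h1 h2] := hN n Nn ne dn.
  by rewrite ler_distlC h1 /=; exact: le_trans (yx n) h2.
apply/eqoP => e e0; apply: near_even_infty.
have [N hN] := limit (e / 2) (divr_gt0 e0 (ltr0Sn R 1)).
exists N => n Nn ne dn; have [h1 h2] := hN n Nn ne dn.
have n0 : (0 : R) < n%:R by rewrite ltr0n; exact: leq_ltn_trans dn.
rewrite ger0_norm ?subr_ge0 ?E_MaxBis_le // ger0_norm //.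
rewrite -ler_pdivrMr // mulrBl -/(x n) -/(y n); lra.
Qed.
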